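(* Let $r\in[1,\infty)$ and $k\in\{1,2,3\}$. Let $\mathbf{S}^{(k)}$ be the multilinear Littlewood--Paley square operator whose kernel $\mathcal{K}^{(k)}$ satisfies the $\mathbb{B}_k$-valued multilinear $L^r$-H\''ormander condition. Then $\mathbf{S}^{(k)}$ is a $\mathbb{B}_k$-valued multilinear bounded oscillation operator with respect to $\mathscr{B}$ and the exponent $r$, where $\mathscr{B}$ is the collection of all cubes in $\mathbb{R}^n$ with sides parallel to the coordinate axes.
   Context: Setting: $(\mathbb{R}^n,\mathcal{L}^n)$ with Lebesgue measure; $\mathscr{B}$ is a ball-basis with $Q^*:=5Q$ for each cube $Q$ ($\lambda Q$ is the concentric dilate). Square operators. Fix $\lambda>2m$ and $\eta\in(0,\infty)$; $\mathbb{R}^{n+1}_+=\mathbb{R}^n\times(0,\infty)$, $\Gamma(x):=\{(y,t)\in\mathbb{R}^{n+1}_+:|y-x|<\eta t\}$. For $t>0$ let $T_t$ be an $m$-linear operator (initially from $\mathcal{S}(\mathbb{R}^n)\times\cdots\times\mathcal{S}(\mathbb{R}^n)$, Schwartz functions, to measurable functions on $\mathbb{R}^n$, and considered on all functions involved) with kernel $K_t$ defined on $\mathbb{R}^{n(m+1)}\setminus\{x=y_1=\cdots=y_m\}$: $T_t(\vec f)(x)=\int_{\mathbb{R}^{nm}}K_t(x,\vec y)\prod_{i=1}^mf_i(y_i)\,d\vec y$ for $x\notin\bigcap_i\operatorname{supp}f_i$. Define $\mathbf{S}^{(1)}(\vec f)(x):=(\int_0^\infty|T_t(\vec f)(x)|^2\frac{dt}t)^{1/2}$,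 $\mathbf{S}^{(2)}(\vec f)(x):=(\iint_{\Gamma(x)}|T_t(\vec f)(z)|^2\frac{dz\,dt}{t^{n+1}})^{1/2}$, $\mathbf{S}^{(3)}(\vec f)(x):=(\iint_{\mathbb{R}^{n+1}_+}(\frac t{t+|x-z|})^{n\lambda}|T_t(\vec f)(z)|^2\frac{dz\,dt}{t^{n+1}})^{1/2}$. Vector-valued form. $\mathbb{B}_1:=L^2((0,\infty),\frac{dt}t)$, $\mathbb{B}_2=\mathbb{B}_3:=L^2(\mathbb{R}^{n+1}_+,\frac{dz\,dt}{t^{n+1}})$. Put $K^{(2)}_{z,t}(x,\vec y):=\mathbf{1}_{\Gamma(0)}(z,t)K_t(x-z,\vec y)$, $K^{(3)}_{z,t}(x,\vec y):=(\frac t{t+|z|})^{n\lambda/2}K_t(x-z,\vec y)$, $T^{(k)}_{z,t}(\vec f)(x):=\int_{\mathbb{R}^{nm}}K^{(k)}_{z,t}(x,\vec y)\prod_if_i(y_i)\,d\vec y$ ($k=2,3$); $\mathcal{K}^{(1)}(x,\vec y):=\{K_t(x,\vec y)\}_{t>0}$, $\mathcal{K}^{(k)}(x,\vec y):=\{K^{(k)}_{z,t}(x,\vec y)\}_{(z,t)}$, $\mathcal{T}^{(1)}(\vec f)(x):=\{T_t(\vec f)(x)\}_{t>0}$, $\mathcal{T}^{(k)}(\vec f)(x):=\{T^{(k)}_{z,t}(\vec f)(x)\}_{(z,t)}$ ($k=2,3$). Then $\mathbf{S}^{(k)}(\vec f)(x)=\|\mathcal{T}^{(k)}(\vec f)(x)\|_{\mathbb{B}_k}$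 and $\mathcal{K}^{(k)}$ is the kernel of $\mathcal{T}^{(k)}$. $L^r$-H\''ormander condition. With $R_j(Q):=(2^jQ)^m\setminus(2^{j-1}Q)^m$, $j\ge1$, $\mathcal{K}^{(k)}$ satisfies the $\mathbb{B}_k$-valued multilinear $L^r$-H\''ormander condition if $$\sup_{Q\in\mathscr{B},\,x\in\frac12Q}|Q|^m\bigg(\frac1{|2Q|^m}\int_{R_1(Q)}\|\mathcal{K}^{(k)}(x,\vec y)\|_{\mathbb{B}_k}^{r'}d\vec y\bigg)^{1/r'}<\infty,$$ $$\sup_{Q\in\mathscr{B},\,x,x'\in\frac12Q}\sum_{j=1}^\infty|2^jQ|^m\bigg(\frac1{|2^jQ|^m}\int_{R_j(Q)}\|\mathcal{K}^{(k)}(x,\vec y)-\mathcal{K}^{(k)}(x',\vec y)\|_{\mathbb{B}_k}^{r'}d\vec y\bigg)^{1/r'}<\infty,$$ where for $r=1$ the normalized integrals with power $r'$ are replaced by essential suprema over $R_j(Q)$. Bounded oscillation. Let $\langle f\rangle_{Q,r}:=(\frac1{|Q|}\int_Q|f|^r)^{1/r}$, $\lfloor f\rfloor_{Q,r}:=\sup_{Q'\in\mathscr{B},Q'\supset Q}\langle f\rangle_{Q',r}$, $\vec f\mathbf{1}_E=(f_1\mathbf{1}_E,\ldots,f_m\mathbf{1}_E)$. $T$ with $T(\vec f)(x)=\|\mathcal{T}(\vec f)(x)\|_{\mathbb{B}}$, $\mathcal{T}$ being $\mathbb{B}$-valued and $m$-linear, is a $\mathbb{B}$-valued multilinear bounded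 oscillation operator with respect to $\mathscr{B}$ and $r$ if there are constants $\mathfrak{C}_1,\mathfrak{C}_2\in(0,\infty)$ such that: (T1) for every $Q_0\in\mathscr{B}$ there is $Q\in\mathscr{B}$, $Q\supsetneq Q_0$, such that for all $\vec f\in L^r(\mathbb{R}^n)^m$, $\sup_{x\in Q_0}\|\mathcal{T}(\vec f\mathbf{1}_{Q^*})(x)-\mathcal{T}(\vec f\mathbf{1}_{Q_0^*})(x)\|_{\mathbb{B}}\le\mathfrak{C}_1\prod_i\langle f_i\rangle_{Q^*,r}$; (T2) for every $Q\in\mathscr{B}$ and such $\vec f$, $\sup_{x,x'\in Q}\|(\mathcal{T}(\vec f)-\mathcal{T}(\vec f\mathbf{1}_{Q^*}))(x)-(\mathcal{T}(\vec f)-\mathcal{T}(\vec f\mathbf{1}_{Q^*}))(x')\|_{\mathbb{B}}\le\mathfrak{C}_2\prod_i\lfloor f_i\rfloor_{Q,r}$. *)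

(* Defs.v *)
From HB Require Import structures.
From mathcomp Require Import all_boot all_order all_algebra.
From mathcomp Require Import all_classical all_reals all_analysis.
From mathcomp Require Import ess_sup_inf.
From mathcomp.real_closed Require Import complex.

Set Implicit Arguments.
Unset Strict Implicit.
Unset Printing Implicit Defensive.
Import Order.TTheory GRing.Theory Num.Theory.
Import numFieldNormedType.Exports.

Local Open Scope classical_set_scope.
Local Open Scope ring_scope.
Local Open Scope complex_scope.

Fact measure_rV_display : measure_display.
Proof. exact: default_measure_display. Qed.

(* The Borel sigma-algebra of R^n, generated by the coordinates. *)
Section measurable_rV.
Context {R : realType} {n : nat}.

Definition rV_coord (i : 'I_n) (x : 'rV[R]_n) : measurableTypeR R := x ord0 i.

Let rV_set0 : g_sigma_preimage rV_coord set0.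
Proof. exact: sigma_algebra0. Qed.

Let rV_setC A : g_sigma_preimage rV_coord A -> g_sigma_preimage rV_coord (~` A).
Proof. exact: sigma_algebraC. Qed.

Let rV_bigcup (F : _^nat) : (forall i, g_sigma_preimage rV_coord (F i)) ->
  g_sigma_preimage rV_coord (\bigcup_i (F i)).
Proof. exact: sigma_algebra_bigcup. Qed.

HB.instance Definition _ := @isMeasurable.Build measure_rV_display
  'rV[R]_n (g_sigma_preimage rV_coord) rV_set0 rV_setC rV_bigcup.

End measurable_rV.

Section pushforward_sigma_finite.
Local Open Scope ereal_scope.
Context d1 d2 (T1 : measurableType d1) (T2 : measurableType d2) (R : realType).
Variables (mu : {sigma_finite_measure set T1 -> \bar R}).
Variables (f : T1 -> T2) (g : T2 -> T1).
Hypotheses (mf : measurable_fun setT f) (mg : measurable_fun setT g).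
Hypothesis fK : cancel f g.

(* The image measure, carrying a proof that it is sigma-finite; [g] witnesses
   that [f] is injective with measurable left inverse. *)
Definition image_measure of measurable_fun setT f & measurable_fun setT g
  & cancel f g := pushforward mu f.

Let nu := image_measure mf mg fK.

Let nu0 : nu set0 = 0.
Proof. by rewrite /nu /image_measure /pushforward preimage_set0 measure0. Qed.

Let nu_ge0 A : 0 <= nu A.
Proof. exact: measure_ge0. Qed.

Let nu_sigma_additive : semi_sigma_additive nu.
Proof.
move=> F mF tF mUF; rewrite /nu /image_measure /pushforward preimage_bigcup.
apply: measure_semi_sigma_additive.
- by move=> n; rewrite -[X in measurable X]setTI; exact: mf.
- apply/trivIsetP => /= i j _ _ ij; rewrite -preimage_setI.
  by move/trivIsetP : tF => /(_ _ _ _ _ ij) ->//; rewrite preimage_set0.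
- by rewrite -preimage_bigcup -[X in measurable X]setTI; exact: mf.
Qed.

HB.instance Definition _ := isMeasure.Build _ _ _ nu
  nu0 nu_ge0 nu_sigma_additive.

Let nu_sigma_finite : sigma_finite setT nu.
Proof.
have [F FT mF] := sigma_finiteT mu.
exists (fun i => g @^-1` F i); first by rewrite -preimage_bigcup -FT preimage_setT.
move=> i; have [mFi Fi] := mF i; split.
  by rewrite -[X in measurable X]setTI; exact: mg.
rewrite /nu /image_measure /pushforward -comp_preimage.
by rewrite (_ : g \o f = id) ?preimage_id//; apply/funext => x /=; rewrite fK.
Qed.

HB.instance Definition _ := Measure_isSigmaFinite.Build _ _ _ nu nu_sigma_finite.

End pushforward_sigma_finite.

Section product_sigma_finite.
Local Open Scope ereal_scope.
Context d1 d2 (T1 : measurableType d1) (T2 : measurableType d2) (R : realType).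
Variables (m1 : {sigma_finite_measure set T1 -> \bar R}).
Variables (m2 : {sigma_finite_measure set T2 -> \bar R}).

(* An alias of [m1 \x m2] on which the sigma-finite structure is inferred; on
   [m1 \x m2] itself the library's subprobability instance takes precedence. *)
Definition sigma_finite_product := m1 \x m2.

HB.instance Definition _ := Measure.on sigma_finite_product.

Let product_sigma_finite : sigma_finite setT sigma_finite_product.
Proof.
have /sigma_finiteP[F [TF ndF Foo]] := sigma_finiteT m1.
have /sigma_finiteP[G [TG ndG Goo]] := sigma_finiteT m2.
exists (fun n => F n `*` G n).
  rewrite -setXTT TF TG predeqE => -[x y]; split.
    move=> [/= [n _ Fnx] [k _ Gky]]; exists (maxn n k) => //; split.
    - by move: x Fnx; exact/subsetPset/ndF/leq_maxl.
    - by move: y Gky; exact/subsetPset/ndG/leq_maxr.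
  by move=> [n _ []/= ? ?]; split; exists n.
move=> k; have [? ?] := Foo k; have [? ?] := Goo k.
split; first exact: measurableX.
by rewrite /sigma_finite_product product_measure1E// lte_mul_pinfty// ge0_fin_numE.
Qed.

HB.instance Definition _ :=
  Measure_isSigmaFinite.Build _ _ _ sigma_finite_product product_sigma_finite.

End product_sigma_finite.

Section power_measure.
Context d (T : measurableType d) (R : realType).
Variable mu : {sigma_finite_measure set T -> \bar R}.

Definition tcons n (p : T * n.-tuple T) : n.+1.-tuple T := [tuple of p.1 :: p.2].
Definition tuncons n (t : n.+1.-tuple T) : T * n.-tuple T :=
  (thead t, [tuple of behead t]).

Lemma measurable_tcons n : measurable_fun setT (@tcons n).
Proof. exact: measurable_cons. Qed.

Lemma measurable_tuncons n : measurable_fun setT (@tuncons n).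
Proof.
apply: measurable_fun_pair => /=; last exact: measurable_behead.
exact: measurable_tnth.
Qed.

Lemma tconsK n : cancel (@tcons n) (@tuncons n).
Proof. by move=> [x t]; congr pair; apply/val_inj. Qed.

(* mu x ... x mu (n factors) on T^n. *)
Fixpoint power_measure n : {sigma_finite_measure set (n.-tuple T) -> \bar R} :=
  if n is n'.+1 then
    image_measure
      (sigma_finite_product mu (power_measure n'))
      (@measurable_tcons n') (@measurable_tuncons n') (@tconsK n')
  else \d_([tuple] : 0.-tuple T).

End power_measure.

Section lebesgue_rV.
Context (R : realType).

Definition rV_of_tuple n (t : n.-tuple (measurableTypeR R)) : 'rV[R]_n :=
  \row_i tnth t i.
Definition tuple_of_rV n (x : 'rV[R]_n) : n.-tuple (measurableTypeR R) :=
  [tuple rV_coord i x | i < n].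

Lemma measurable_rV_of_tuple n : measurable_fun setT (@rV_of_tuple n).
Proof.
move=> _ Y mY; rewrite setTI.
suff: measurable `<=` image_set_system setT (@rV_of_tuple n) measurable.
  by move=> /(_ _ mY); rewrite /image_set_system /= setTI.
apply: smallest_sub.
  exact/sigma_algebra_image/sigma_algebra_measurable.
rewrite -bigcup_seq => A [i _ [B mB <-]].
rewrite /image_set_system/= !setTI -comp_preimage.
rewrite (_ : _ \o _ = @tnth n _ ^~ i); last by apply/funext => t /=; rewrite /rV_coord mxE.
by rewrite -[X in measurable X]setTI; exact: measurable_tnth.
Qed.

Lemma measurable_tuple_of_rV n : measurable_fun setT (@tuple_of_rV n).
Proof.
apply/measurable_fun_tnthP => i.
rewrite (_ : _ \o _ = rV_coord i); last by apply/funext => x /=; rewrite tnth_mktuple.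
move=> _ Y mY; rewrite setTI; apply: sub_sigma_algebra.
by rewrite -bigcup_seq; exists i; [exact: mem_index_enum|exists Y; rewrite ?setTI].
Qed.

Lemma rV_of_tupleK n : cancel (@rV_of_tuple n) (@tuple_of_rV n).
Proof. by move=> t; apply: eq_from_tnth => i; rewrite tnth_mktuple /rV_coord mxE. Qed.

(* Lebesgue measure on R^n (restricted to Borel sets). *)
Definition leb n : {sigma_finite_measure set 'rV[R]_n -> \bar R} :=
  image_measure (power_measure (@lebesgue_measure R) n)
    (@measurable_rV_of_tuple n) (@measurable_tuple_of_rV n) (@rV_of_tupleK n).

End lebesgue_rV.

Notation normc := ComplexField.Normc.normc.

Section complex_integration.
Context d (T : measurableType d) (R : realType).
Variable mu : {measure set T -> \bar R}.
Implicit Types (D : set T) (f : T -> R[i]).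

Definition cmeasurable_fun D f :=
  measurable_fun D (fun x => complex.Re (f x)) /\
  measurable_fun D (fun x => complex.Im (f x)).

Definition cintegrable f :=
  mu.-integrable setT (fun x => (complex.Re (f x))%:E) /\
  mu.-integrable setT (fun x => (complex.Im (f x))%:E).

Definition cintegral f : R[i] :=
  (\int[mu]_x complex.Re (f x)) +i* (\int[mu]_x complex.Im (f x)).

End complex_integration.

Section cubes.
Context (R : realType) (n : nat).

(* Closed cubes with sides parallel to the axes. *)
Record cube := Cube {
  cube_center : 'rV[R]_n; cube_side : R; cube_side_gt0 : 0 < cube_side }.

(* The concentric dilate lambda Q, as a set. *)
Definition dilate (lambda : R) (Q : cube) : set 'rV[R]_n :=
  [set x | forall i, `|x ord0 i - cube_center Q ord0 i| <= lambda * cube_side Q / 2].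

Definition cube_set (Q : cube) := dilate 1 Q.

Definition star (Q : cube) := dilate 5 Q.

(* |A|; only used for cubes and their dilates, whose measure is finite. *)
Definition vol (A : set 'rV[R]_n) : R := fine (leb R n A).

(* <f>_{A,r}, with values in [0, +oo] *)
Definition average (r : R) (f : 'rV[R]_n -> R[i]) (A : set 'rV[R]_n) : \bar R :=
  (((vol A)^-1)%:E * \int[leb R n]_(y in A) (normc (f y) `^ r)%:E)%E `^ r^-1.

(* The supremum of <f>_{Q',r} over all cubes Q' containing Q *)
Definition maximal_average (r : R) (f : 'rV[R]_n -> R[i]) (Q : cube) : \bar R :=
  ereal_sup [set average r f (cube_set Q') |
             Q' in [set Q' | cube_set Q `<=` cube_set Q']].

Definition Lr (r : R) (f : 'rV[R]_n -> R[i]) :=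
  cmeasurable_fun setT f /\
  (\int[leb R n]_y ((normc (f y)) `^ r)%:E < +oo)%E.

Definition supp (f : 'rV[R]_n -> R[i]) := closure [set y | f y != 0].

Definition enorm (x : 'rV[R]_n) : R := Num.sqrt (\sum_i (x ord0 i) ^+ 2).

End cubes.

Section multilinear.
Context (R : realType) (n m : nat).

Local Notation Rn := 'rV[R]_n.
Local Notation Rnm := (m.-tuple 'rV[R]_n).
Local Notation vfun := ('I_m -> Rn -> R[i]).

Definition leb_m : {sigma_finite_measure set Rnm -> \bar R} :=
  power_measure (leb R n) m.

Definition vLr (r : R) (f : vfun) := forall i, Lr r (f i).

Definition vrestrict (f : vfun) (E : set Rn) : vfun := fun i x => (\1_E x)%:C * f i x.

Definition vupdate (f : vfun) (i : 'I_m) (g : Rn -> R[i]) : vfun :=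
  fun j => if j == i then g else f j.

(* The integrand k(y_1, ..., y_m) f_1(y_1) ... f_m(y_m). *)
Definition kernel_integrand (k : Rnm -> R[i]) (f : vfun) (y : Rnm) : R[i] :=
  k y * \prod_(i < m) f i (tnth y i).

Definition power_set (A : set Rn) : set Rnm := [set y | forall i, A (tnth y i)].

(* R_j(Q), for j >= 1 *)
Definition annulus (j : nat) (Q : cube R n) : set Rnm :=
  power_set (dilate (2 ^+ j) Q) `\` power_set (dilate (2 ^+ j.-1) Q).

(* The normalized L^{r'} norm over R_j(Q) of g >= 0, with r' = r / (r - 1). For
   r = 1 it is the essential supremum over R_j(Q); as g >= 0, it is that of g
   extended by 0. *)
Definition annulus_mean (r : R) (j : nat) (Q : cube R n) (g : Rnm -> \bar R) :
    \bar R :=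
  if r == 1 then ess_sup leb_m (g \_ (annulus j Q))
  else let r' := r / (r - 1) in
    ((((vol (dilate (2 ^+ j) Q) ^+ m)^-1)%:E *
      \int[leb_m]_(y in annulus j Q) (g y `^ r')) `^ r'^-1)%E.

Section vector_valued.
Context (Omega : Type).
(* The norm of B, defined on all functions on the parameter space Omega, with
   value +oo outside B. *)
Variable normB : (Omega -> R[i]) -> \bar R.

Definition size_term (r : R) (KK : Rn -> Rnm -> Omega -> R[i])
    (Q : cube R n) (x : Rn) : \bar R :=
  (vol (cube_set Q) ^+ m)%:E * annulus_mean r 1 Q (fun y => normB (KK x y)).

Definition smoothness_term (r : R) (KK : Rn -> Rnm -> Omega -> R[i])
    (Q : cube R n) (x x' : Rn) : \bar R :=
  let dK y : Omega -> R[i] := (fun o => KK x y o - KK x' y o)%R in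
  \sum_(1 <= j <oo) (vol (dilate (2 ^+ j) Q) ^+ m)%:E *
    annulus_mean r j Q (fun y => normB (dK y)).

(* The B-valued multilinear L^r-Hormander condition. *)
Definition hormander (r : R) (KK : Rn -> Rnm -> Omega -> R[i]) :=
  (ereal_sup [set v | exists Q : cube R n, exists2 x, dilate 2^-1 Q x &
     v = size_term r KK Q x] < +oo)%E /\
  (ereal_sup [set v | exists Q : cube R n, exists x x',
     [/\ dilate 2^-1 Q x, dilate 2^-1 Q x' &
     v = smoothness_term r KK Q x x']] < +oo)%E.

(* Equality in B means that the difference has norm 0. *)
Definition B_multilinear (r : R) (TT : vfun -> Rn -> Omega -> R[i]) :=
  forall (f : vfun) (i : 'I_m) (g h : Rn -> R[i]) (c : R[i]) (x : Rn),
    vLr r f -> Lr r g -> Lr r h ->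
    normB (fun o =>
      TT (vupdate f i (fun y => c * g y + h y)) x o -
      (c * TT (vupdate f i g) x o + TT (vupdate f i h) x o)) = 0%E.

Definition condition_T1 (r : R) (TT : vfun -> Rn -> Omega -> R[i]) (C1 : R) :=
  forall Q0 : cube R n, exists2 Q : cube R n, cube_set Q0 `<` cube_set Q &
  forall f, vLr r f ->
  let diff x : Omega -> R[i] := fun o =>
    TT (vrestrict f (star Q)) x o - TT (vrestrict f (star Q0)) x o in
  (ereal_sup [set normB (diff x) | x in cube_set Q0] <=
     C1%:E * \prod_(i < m) average r (f i) (star Q))%E.

Definition condition_T2 (r : R) (TT : vfun -> Rn -> Omega -> R[i]) (C2 : R) :=
  forall (Q : cube R n) f, vLr r f ->
  let diff x : Omega -> R[i] := fun o =>
    TT f x o - TT (vrestrict f (star Q)) x o in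
  let osc x x' : Omega -> R[i] := fun o => diff x o - diff x' o in
  (ereal_sup [set v | exists x x', [/\ cube_set Q x, cube_set Q x' &
     v = normB (osc x x')]] <=
     C2%:E * \prod_(i < m) maximal_average r (f i) Q)%E.

(* S is a B-valued multilinear bounded oscillation operator, with underlying
   vector-valued operator TT. *)
Definition bounded_oscillation (r : R) (S : vfun -> Rn -> \bar R)
    (TT : vfun -> Rn -> Omega -> R[i]) :=
  [/\ forall f x, vLr r f -> S f x = normB (TT f x),
      B_multilinear r TT &
      exists C1 C2 : R, [/\ 0 < C1, 0 < C2, condition_T1 r TT C1 & condition_T2 r TT C2]].

End vector_valued.

Section square_operators.
Variables (lambda eta : R).
Variables (K : R -> Rn -> Rnm -> R[i]) (T : R -> vfun -> Rn -> R[i]).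

Inductive square_index := Square1 | Square2 | Square3.

Definition upper_half_space : set (Rn * R)%type := [set p | 0 < p.2].

Definition leb_half_space :
    {sigma_finite_measure set (Rn * measurableTypeR R)%type -> \bar R} :=
  sigma_finite_product (leb R n) (@lebesgue_measure R).

Definition Gamma (x : Rn) : set (Rn * R)%type :=
  [set p | 0 < p.2 /\ enorm (p.1 - x) < eta * p.2].

Definition weight (z : Rn) (t a : R) : R := (t / (t + enorm z)) `^ a.

(* The parameter space of B_k. *)
Definition Omega (k : square_index) : Type :=
  match k with Square1 => R | _ => (Rn * R)%type end.

(* The norm of L^2((0,oo), dt/t), resp. L^2(R^{n+1}_+, dz dt/t^{n+1}). *)
Definition norm_B (k : square_index) : (Omega k -> R[i]) -> \bar R :=
  match k return (Omega k -> R[i]) -> \bar R with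
  | Square1 => fun F => ((\int[@lebesgue_measure R]_(t in [set t | (0 < t)%R])
      (normc (F t) ^+ 2 / t)%:E) `^ 2^-1)%E
  | _ => fun F => ((\int[leb_half_space]_(p in upper_half_space)
      (normc (F p) ^+ 2 / p.2 ^+ n.+1)%:E) `^ 2^-1)%E
  end.

(* S^(k) *)
Definition square_op (k : square_index) (f : vfun) (x : Rn) : \bar R :=
  match k with
  | Square1 => ((\int[@lebesgue_measure R]_(t in [set t | (0 < t)%R])
      (normc (T t f x) ^+ 2 / t)%:E) `^ 2^-1)%E
  | Square2 => ((\int[leb_half_space]_(p in Gamma x)
      (normc (T p.2 f p.1) ^+ 2 / p.2 ^+ n.+1)%:E) `^ 2^-1)%E
  | Square3 => ((\int[leb_half_space]_(p in upper_half_space)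
      (weight (x - p.1) p.2 (n%:R * lambda) *
       (normc (T p.2 f p.1) ^+ 2 / p.2 ^+ n.+1))%:E) `^ 2^-1)%E
  end.

(* K_t is only defined off the diagonal x = y_1 = ... = y_m: the values of [K]
   there are replaced by 0 (a Lebesgue null set of y's). *)
Definition off_diagonal (x : Rn) (y : Rnm) := [exists i, tnth y i != x].

Definition kernel_ext (t : R) (x : Rn) (y : Rnm) : R[i] :=
  if off_diagonal x y then K t x y else 0.

(* K^(k) *)
Definition vkernel (k : square_index) : Rn -> Rnm -> Omega k -> R[i] :=
  match k return Rn -> Rnm -> Omega k -> R[i] with
  | Square1 => fun x y t => kernel_ext t x y
  | Square2 => fun x y p => (\1_(Gamma 0) p)%:C * kernel_ext p.2 (x - p.1) y
  | Square3 => fun x y p =>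
      (weight p.1 p.2 (n%:R * lambda / 2))%:C * kernel_ext p.2 (x - p.1) y
  end.

(* T^(k) *)
Definition voperator (k : square_index) : vfun -> Rn -> Omega k -> R[i] :=
  match k return vfun -> Rn -> Omega k -> R[i] with
  | Square1 => fun f x t => T t f x
  | Square2 => fun f x p =>
      cintegral leb_m (kernel_integrand (fun y => @vkernel Square2 x y p) f)
  | Square3 => fun f x p =>
      cintegral leb_m (kernel_integrand (fun y => @vkernel Square3 x y p) f)
  end.

(* T_t(f)(x) is given by the absolutely convergent kernel integral. *)
Definition represented (t : R) (f : vfun) (x : Rn) :=
  cintegrable leb_m (kernel_integrand (kernel_ext t x) f) /\
  T t f x = cintegral leb_m (kernel_integrand (kernel_ext t x) f).

Definition measurable_kernel_family :=
  cmeasurable_fun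
    [set q : Rn * Rnm * measurableTypeR R | 0 < q.2 /\ off_diagonal q.1.1 q.1.2]
    (fun q => K q.2 q.1.1 q.1.2).

Definition multilinear_operator_family (r : R) :=
  forall t (f : vfun) (i : 'I_m) (g h : Rn -> R[i]) (c : R[i]) (x : Rn),
    0 < t -> vLr r f -> Lr r g -> Lr r h ->
    T t (vupdate f i (fun y => c * g y + h y)) x =
      c * T t (vupdate f i g) x + T t (vupdate f i h) x.

Definition measurable_operator_family (r : R) :=
  forall f : vfun, vLr r f ->
    cmeasurable_fun [set p : Rn * measurableTypeR R | 0 < p.2]
      (fun p => T p.2 f p.1).

Definition has_kernel (r : R) :=
  forall t (f : vfun) (x : Rn), 0 < t -> vLr r f ->
    ~ (forall i, supp (f i) x) -> represented t f x.

(* For k = 2, 3 the integral defining T^(k)_{z,t}(f)(x) involves K_t(x - z, .)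
   for all z, hence also at points of the supports of the f_i. This states that
   the integral makes sense and is the one of T_t, which is what turns
   S^(k)(f)(x) into the norm of T^(k)(f)(x). *)
Definition has_kernel_ae (r : R) :=
  forall f : vfun, vLr r f ->
    \forall p \ae leb_half_space, 0 < p.2 -> represented p.2 f p.1.

End square_operators.
End multilinear.

(* Main.v *)
Require Import Defs.
From HB Require Import structures.
From mathcomp Require Import all_boot all_order all_algebra.
From mathcomp Require Import all_classical all_reals all_analysis.
From mathcomp Require Import ring lra measurable_realfun ess_sup_inf.
From mathcomp.real_closed Require Import complex.

Set Implicit Arguments.
Unset Strict Implicit.
Unset Printing Implicit Defensive.
Import Order.TTheory GRing.Theory Num.Theory.
Local Open Scope ring_scope.

(** The three square operators have the same shape: the norm of B_k is the norm
    of a weighted L^2 space over a parameter space W, and the values of the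
    operator are complex valued functions on W. Everything but the comparison
    of the operator with its kernel is therefore carried out for an arbitrary
    weighted L^2 space.

    Fix a cube Q and put f1 for the restriction of f to Q^* = 5Q. On Q the
    function T(f) - T(f1) is given by the kernel integral of
      K(x, y) (prod f_i(y_i) - prod f1_i(y_i)),
    whose second factor vanishes when all y_i lie in Q^*. This is the property
    [far_represented]. Given that, Minkowski's integral inequality for L^2
    ([integral_minkowski_L2], [weighted_norm_cintegral]) moves the norm of B_k
    under the integral in y, and Hoelder's inequality on each annulus R_j(Q')
    ([annulus_hoelder]) splits off the averages of the f_i.
    - For (T1) the larger cube is Q = 2 Q_0. With Q' = 5 Q_0 the set where
      exactly one of the two products of indicators of Q^* and Q_0^* vanishes
      is (10 Q_0)^m \ (5 Q_0)^m = R_1(Q'), and Q_0 lies in Q'/2, so that the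
      size condition applies ([condition_T1_of_size]).
    - For (T2), with Q' = 5Q, the complement of (Q^* )^m is the disjoint union
      of the R_j(Q'), j >= 1, and every 2^j Q' contains Q, so that each average
      over 2^j Q' is at most the maximal average over Q. The smoothness
      condition then bounds the sum over j ([condition_T2_of_smoothness]).

    It remains to establish [far_represented]. For S^(1) the kernel
    representation of T_t(f) at x is available as soon as x is outside the
    support of one f_i; replacing the f_i by their restrictions one at a time
    writes T_t(f) - T_t(f1) as a sum of m such terms ([telescoping]). For S^(2)
    and S^(3) the representation holds at almost every (x - z, t), hence for
    almost every (z, t), since z |-> x - z preserves Lebesgue measure. The same
    change of variables turns S^(k)(f)(x) into the norm of T^(k)(f)(x). *)

(** * Integral inequalities *)

Section integral_inequalities.
Import numFieldNormedType.Exports HBNNSimple.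
Local Open Scope classical_set_scope.
Local Open Scope ereal_scope.
Context d (T : measurableType d) (R : realType).
Variable mu : {measure set T -> \bar R}.

(** The integral of a nonnegative function is a supremum over the simple
    functions below it, and a simple function can be cut to the complement of a
    null set; so monotonicity holds for functions that are not measurable. This
    allows to compare operator values known only by an almost everywhere
    formula. *)
Lemma ae_le_integral_nomeas (D : set T) (f g : T -> \bar R) : measurable D ->
  (forall x, D x -> 0 <= f x) -> (forall x, D x -> 0 <= g x) ->
  {ae mu, forall x, D x -> f x <= g x} ->
  \int[mu]_(x in D) f x <= \int[mu]_(x in D) g x.
Proof.
move=> mD f0 g0 [N [mN N0 fgN]].
rewrite ge0_integralE// [leRHS]ge0_integralE//.
apply: ge_ereal_sup => _ /= [h hf <-].
have mNC : measurable (~` N) by exact: measurableC.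
apply: (@le_trans _ _ (sintegral mu (h \_ (~` N)))); last first.
  rewrite mrestrict.
  apply: ereal_sup_ubound; exists (proj_nnsfun h mNC) => //= x.
  rewrite /patch; case: ifPn => [|xD].
    rewrite inE => Dx.
    rewrite mindicE; case: (boolP (x \in ~` N)) => [|_]; last by rewrite mulr0 g0.
    rewrite inE mulr1 => nNx.
    have fg : f x <= g x.
      by apply: contrapT => h'; apply: nNx; apply: fgN => /(_ Dx).
    by apply: le_trans fg; have := hf x; rewrite /patch mem_set.
  have h0 : (h x <= 0)%R by have := hf x; rewrite /patch (negbTE xD) lee_fin.
  by rewrite mindicE lee_fin; case: (x \in _); rewrite ?mulr0// mulr1.
have -> : sintegral mu h = \int[mu]_x (h x)%:E by rewrite integral_nnsfun// patch_setT.
rewrite -integral_nnsfun// -(setTD N).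
rewrite (@ge0_negligible_integral _ _ _ mu setT N)//; first exact/measurable_EFinP.
by move=> x _; rewrite lee_fin.
Qed.

(** Extended real values of [f] are needed because the norm of a kernel may be
    infinite. If the L^p norm of [f] is finite, then so is [f] almost everywhere
    and the real valued inequality applies; if it is infinite, then the right
    hand side is infinite unless [g] vanishes almost everywhere. *)
Lemma hoelder_ereal (f : T -> \bar R) (g : T -> R) (p q : R) :
  measurable_fun setT f -> measurable_fun setT g ->
  (forall x, 0 <= f x) -> (forall x, 0 <= g x)%R ->
  (0 < p)%R -> (0 < q)%R -> (p^-1 + q^-1 = 1)%R ->
  \int[mu]_x (f x * (g x)%:E) <=
    (\int[mu]_x (f x `^ p)) `^ p^-1 * (\int[mu]_x (g x `^ q)%:E) `^ q^-1.
Proof.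
move=> mf mg f0 g0 p0 q0 pq.
have mfp : measurable_fun setT (fun x => f x `^ p).
  exact: (measurableT_comp (measurable_poweR _)).
have mgq : measurable_fun setT (fun x => (g x `^ q)%:E).
  apply/measurable_EFinP.
  by apply: (@measurableT_comp _ _ _ _ _ _ (@powR R ^~ q)) => //; exact: measurable_powR.
have ifp0 : 0 <= \int[mu]_x (f x `^ p).
  by apply: integral_ge0 => x _; exact: poweR_ge0.
have igq0 : 0 <= \int[mu]_x (g x `^ q)%:E.
  by apply: integral_ge0 => x _; rewrite lee_fin powR_ge0.
have [fpoo|fpoo] := eqVneq (\int[mu]_x (f x `^ p)) +oo.
  have [gq0|gq0] := eqVneq (\int[mu]_x (g x `^ q)%:E) 0.
    rewrite [leLHS](_ : _ = 0) ?mule_ge0 ?poweR_ge0//.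
    apply/eqP; rewrite eq_le integral_ge0 ?andbT; last first.
      by move=> x _; rewrite mule_ge0// lee_fin.
    rewrite -(integral0 mu setT); apply: ae_le_integral_nomeas => //.
      by move=> x _; rewrite mule_ge0// lee_fin.
    have := (ae_eq_integral_abs mu measurableT mgq).1.
    have -> : \int[mu]_x `|(g x `^ q)%:E| = 0.
      by rewrite -gq0; apply: eq_integral => x _; rewrite gee0_abs// lee_fin powR_ge0.
    move=> /(_ erefl); apply: filterS => x /(_ I)/= [gx0] _.
    have /eqP := gx0; rewrite powR_eq0 => /andP[/eqP -> _].
    by rewrite mule0.
  rewrite fpoo poweRyr ?invr_eq0 ?(gt_eqF p0)// gt0_mulye ?leey//.
  by rewrite poweR_gt0// lt0e gq0.
pose f' x := fine (f x).
have mf' : measurable_fun setT f' by exact: measurableT_comp.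
have f'0 x : (0 <= f' x)%R by exact: fine_ge0.
have ffin : {ae mu, forall x, f x \is a fin_num}.
  have : mu.-integrable setT (fun x => f x `^ p).
    apply/integrableP; split => //.
    under eq_integral do rewrite gee0_abs ?poweR_ge0//.
    by rewrite ltey.
  move=> /(integrable_ae measurableT); apply: filterS => x /(_ I).
  rewrite ge0_fin_numE ?poweR_ge0// => fxp; rewrite ge0_fin_numE//.
  by apply: lty_poweRy fxp; rewrite gt_eqF.
apply: (@le_trans _ _ (\int[mu]_x (f' x * g x)%:E)).
  apply: ae_le_integral_nomeas => //.
  - by move=> x _; rewrite mule_ge0// lee_fin.
  - by move=> x _; rewrite lee_fin mulr_ge0.
  - by apply: filterS ffin => x fx _; rewrite EFinM fineK.
have := @hoelder _ _ _ mu f' g p q mf' mg p0 q0 pq.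
rewrite Lnorm1; under eq_integral.
  by move=> x _; rewrite /= ger0_norm ?mulr_ge0//; over.
move=> /le_trans; apply; rewrite unlock/=.
apply: lee_pmul; [exact: poweR_ge0|exact: poweR_ge0| |].
  have p10 : (0 <= p^-1)%R by rewrite invr_ge0 ltW.
  apply: (gt0_ler_poweR p10).
  - rewrite in_itv/= leey andbT.
    by apply: integral_ge0 => x _; rewrite lee_fin powR_ge0.
  - by rewrite in_itv/= leey andbT.
  apply: ae_le_integral_nomeas => //.
  - by move=> x _; exact: poweR_ge0.
  - by apply: filterS ffin => x fx _; rewrite ger0_norm// -poweR_EFin fineK.
by under eq_integral do rewrite ger0_norm//.
Qed.

Lemma integral_cauchy_schwarz (f g : T -> R) :
  measurable_fun setT f -> measurable_fun setT g ->
  (forall x, 0 <= f x)%R -> (forall x, 0 <= g x)%R ->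
  \int[mu]_x (f x * g x)%:E <=
    (\int[mu]_x (f x ^+ 2)%:E) `^ 2^-1 * (\int[mu]_x (g x ^+ 2)%:E) `^ 2^-1.
Proof.
move=> mf mg f0 g0.
have sqE (h : T -> R) : (forall x, 0 <= h x)%R ->
    \int[mu]_x (h x ^+ 2)%:E = \int[mu]_x (h x `^ 2)%:E.
  by move=> h0; apply: eq_integral => x _; rewrite powR_mulrn.
rewrite !sqE//.
apply: (@hoelder_ereal (EFin \o f) g 2 2) => //; first exact/measurable_EFinP.
by rewrite [RHS](splitr 1) mul1r.
Qed.

End integral_inequalities.

Section minkowski.
Local Open Scope classical_set_scope.
Local Open Scope ereal_scope.
Context d1 d2 (Y : measurableType d1) (W : measurableType d2) (R : realType).
Variables (mu : {sigma_finite_measure set Y -> \bar R})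
  (nu : {sigma_finite_measure set W -> \bar R}).

(** With I(w) the integral of F(., w) and N(y) the L^2 norm of F(y, .), expand
    I(w)^2 as the double integral of F(y, w) F(y', w) and integrate in w first:
    by Cauchy-Schwarz the result is at most the double integral of N(y) N(y'),
    which is the square of the right hand side. *)
Lemma integral_minkowski_L2 (F : Y * W -> R) :
  measurable_fun setT F -> (forall p, 0 <= F p)%R ->
  (\int[nu]_w ((\int[mu]_y (F (y, w))%:E) ^+ 2)) `^ 2^-1 <=
  \int[mu]_y ((\int[nu]_w (F (y, w) ^+ 2)%:E) `^ 2^-1).
Proof.
move=> mF F0.
have mFE : measurable_fun setT (EFin \o F) by exact/measurable_EFinP.
pose I w := \int[mu]_y (F (y, w))%:E.
pose N y := (\int[nu]_w (F (y, w) ^+ 2)%:E) `^ 2^-1.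
have FE0 p : 0 <= (EFin \o F) p by rewrite lee_fin.
have mI : measurable_fun setT I.
  exact: (measurable_fun_fubini_tonelli_G (EFin \o F)).
have I0 w : 0 <= I w by apply: integral_ge0 => y _; exact: (FE0 (y, w)).
have mN : measurable_fun setT N.
  apply: (measurableT_comp (measurable_poweR _)) => //.
  apply: (measurable_fun_fubini_tonelli_F (fun p => (F p ^+ 2)%:E)).
    by apply/measurable_EFinP; exact: measurable_funX.
  by move=> p; rewrite lee_fin sqr_ge0.
have N0 y : 0 <= N y by exact: poweR_ge0.
have mFy y : measurable_fun setT (fun w => F (y, w)) by exact: measurableT_comp.
have mFw w : measurable_fun setT (fun y => F (y, w)) by exact: measurableT_comp.
pose J := \int[mu]_y N y.
have J0 : 0 <= J by apply: integral_ge0 => y _; exact: N0.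
have inner y : \int[nu]_w ((F (y, w))%:E * I w) <= N y * J.
  have -> : \int[nu]_w ((F (y, w))%:E * I w) =
            \int[nu]_w \int[mu]_y' (F (y, w) * F (y', w))%:E.
    apply: eq_integral => w _.
    rewrite -ge0_integralZl_EFin//; last exact/measurable_EFinP.
    by move=> y' _; rewrite lee_fin.
  rewrite -(fubini_tonelli (fun p : Y * W => (F (y, p.2) * F p)%:E))/=; last 2 first.
  - apply/measurable_EFinP/measurable_funM => //.
    by apply: measurableT_comp (mFy y) _.
  - by move=> p; rewrite lee_fin mulr_ge0.
  rewrite -ge0_integralZl//.
  apply: ae_le_integral_nomeas => //.
  - by move=> y' _; apply: integral_ge0 => w _; rewrite lee_fin mulr_ge0.
  - by move=> y' _; exact: mule_ge0.
  - by apply: aeW => y' _; exact: integral_cauchy_schwarz.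
(* both sides are compared through their squares *)
suff H : \int[nu]_w (I w ^+ 2) <= J ^+ 2.
  have JE : (J ^+ 2) `^ 2^-1 = J.
    have h2 : (2^-1 + 2^-1 = 1 :> R)%R by rewrite [RHS](splitr 1) mul1r.
    rewrite expe2 poweRM// -poweRD ?h2 ?poweRe1//.
    by rewrite add_neq0_poweRD_def// h2 oner_neq0.
  have I20 : 0 <= \int[nu]_w (I w ^+ 2) by apply: integral_ge0 => w _; exact: expe_ge0.
  rewrite -[leRHS]JE; apply: gt0_ler_poweR => //.
    by rewrite in_itv/= leey andbT.
  by rewrite in_itv/= leey andbT mule_ge0.
rewrite expe2 -[in leRHS]ge0_integralZr//.
have -> : \int[nu]_w (I w ^+ 2) = \int[nu]_w \int[mu]_y ((F (y, w))%:E * I w).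
  apply: eq_integral => w _; rewrite expe2 ge0_integralZr// => [|y _].
    exact/measurable_EFinP.
  by rewrite lee_fin.
rewrite -(fubini_tonelli (fun p : Y * W => (F p)%:E * I p.2))/=; last 2 first.
- by apply: emeasurable_funM => //; exact: measurableT_comp mI _.
- by move=> p; rewrite mule_ge0// lee_fin.
apply: ae_le_integral_nomeas => //.
- by move=> y _; apply: integral_ge0 => w _; rewrite mule_ge0// lee_fin.
- by move=> y _; exact: mule_ge0.
- by apply: aeW => y _; exact: inner.
Qed.

End minkowski.

(** * Integration against powers of a measure *)

Section power_measure_theory.
Local Open Scope classical_set_scope.
Local Open Scope ereal_scope.
Context d (T : measurableType d) (R : realType).
Variable mu : {sigma_finite_measure set T -> \bar R}.

Lemma integral_power_measureS n (g : n.+1.-tuple T -> \bar R) :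
  measurable_fun setT g -> (forall t, 0 <= g t) ->
  \int[power_measure mu n.+1]_t g t =
  \int[mu]_x \int[power_measure mu n]_t g (tcons (x, t)).
Proof.
move=> mg g0.
transitivity (\int[pushforward (sigma_finite_product mu (power_measure mu n))
  (@tcons _ T n)]_t g t) => //.
rewrite ge0_integral_pushforward//; last exact: measurable_tcons.
rewrite preimage_setT /sigma_finite_product.
rewrite (fubini_tonelli1 (g \o @tcons _ T n))//=.
exact: measurableT_comp mg (@measurable_tcons _ T n).
Qed.

Lemma integral_power_measure0 (g : 0.-tuple T -> \bar R) :
  (forall t, 0 <= g t) -> measurable_fun setT g ->
  \int[power_measure mu 0]_t g t = g [tuple].
Proof. by move=> g0 mg; rewrite /= integral_dirac// diracT mul1e. Qed.

Lemma measurable_prod_tnth n (f : 'I_n -> T -> \bar R) :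
  (forall i, measurable_fun setT (f i)) ->
  measurable_fun setT (fun t : n.-tuple T => \prod_(i < n) f i (tnth t i)).
Proof.
move=> mf; elim: (index_enum _) => [|i s IH].
  by under eq_fun do rewrite big_nil; exact: measurable_cst.
under eq_fun do rewrite big_cons.
apply: emeasurable_funM => //.
exact: measurableT_comp (mf i) (@measurable_tnth _ T n i).
Qed.

Lemma integral_power_measure_prod n (f : 'I_n -> T -> \bar R) :
  (forall i, measurable_fun setT (f i)) -> (forall i x, 0 <= f i x) ->
  \int[power_measure mu n]_t \prod_(i < n) f i (tnth t i) =
  \prod_(i < n) \int[mu]_x f i x.
Proof.
elim: n f => [|n IH] f mf f0.
  rewrite integral_power_measure0 ?big_ord0//; last exact: measurable_prod_tnth.
  by move=> t; exact: prode_ge0.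
rewrite integral_power_measureS; last 2 first.
- exact: measurable_prod_tnth.
- by move=> t; exact: prode_ge0.
rewrite big_ord_recl -ge0_integralZr//; last first.
  by apply: prode_ge0 => i _; exact: integral_ge0.
apply: eq_integral => x _; rewrite -IH// -ge0_integralZl//; last 2 first.
- exact: (measurable_prod_tnth (f := fun i => f (lift ord0 i))).
- by move=> t _; exact: prode_ge0.
apply: eq_integral => t _; rewrite big_ord_recl; congr (_ * _).
by apply: eq_bigr => i _; rewrite tnthS.
Qed.

Lemma measurable_box n (A : 'I_n -> set T) : (forall i, measurable (A i)) ->
  measurable [set t : n.-tuple T | forall i, A i (tnth t i)].
Proof.
move=> mA.
rewrite (_ : [set _ | _] = \bigcap_(i in [set: 'I_n]) ((@tnth n T)^~ i @^-1` A i)).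
  apply: fin_bigcap_measurable => // i _; rewrite -[X in measurable X]setTI.
  exact: measurable_tnth.
by apply/seteqP; split => t /= At i => [_|]; exact: At.
Qed.

Lemma power_measure_box n (A : 'I_n -> set T) : (forall i, measurable (A i)) ->
  power_measure mu n [set t | forall i, A i (tnth t i)] = \prod_(i < n) mu (A i).
Proof.
move=> mA.
have mB := measurable_box mA.
rewrite -[X in power_measure _ _ X]setIT -(integral_indic _ measurableT)//.
under eq_bigr do rewrite -[X in mu X]setIT -(integral_indic _ measurableT)//.
rewrite -integral_power_measure_prod//; last first.
  by move=> i; apply/measurable_EFinP; exact: measurable_indic.
apply: eq_integral => t _.
rewrite prodEFin indicE; congr (_%:E).
case: (boolP (t \in _)) => [|tA].
  by rewrite inE => tA; rewrite big1// => i _; rewrite indicE mem_set.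
apply/esym/eqP; rewrite prodf_seq_eq0; apply/hasP.
move: tA; rewrite notin_setE => /= /existsNP[i Ati].
by exists i; rewrite ?mem_index_enum//= indicE memNset.
Qed.

(** Maps preserving [mu] act on the coordinates independently, so they preserve
    its powers: Tonelli's theorem reduces this to one coordinate at a time. *)
Lemma integral_power_measure_map n (s : 'I_n -> T -> T)
    (g : n.-tuple T -> \bar R) :
  (forall i, measurable_fun setT (s i)) ->
  (forall i (h : T -> \bar R), measurable_fun setT h -> (forall x, 0 <= h x) ->
    \int[mu]_x h (s i x) = \int[mu]_x h x) ->
  measurable_fun setT g -> (forall t, 0 <= g t) ->
  \int[power_measure mu n]_t g [tuple s i (tnth t i) | i < n] =
  \int[power_measure mu n]_t g t.
Proof.
elim: n s g => [|n IH] s g ms muS mg g0.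
  by apply: eq_integral => t _; rewrite [t]tuple0; congr g; rewrite [LHS]tuple0.
have mmap : measurable_fun setT
    (fun t : n.+1.-tuple T => [tuple s i (tnth t i) | i < n.+1]).
  apply/measurable_fun_tnthP => i.
  rewrite (_ : _ \o _ = s i \o (@tnth n.+1 T)^~ i).
    exact: measurableT_comp (ms i) (@measurable_tnth _ T n.+1 i).
  by apply/funext => t /=; rewrite tnth_mktuple.
have mgc : measurable_fun setT (fun p => g (tcons p)).
  exact: measurableT_comp mg (@measurable_tcons _ T n).
rewrite integral_power_measureS; [|exact: measurableT_comp mmap|by move=> t; exact: g0].
rewrite [RHS]integral_power_measureS; [|exact: mg|exact: g0].
rewrite -[RHS](muS ord0); last 2 first.
- exact: (measurable_fun_fubini_tonelli_F (fun p => g (tcons p))).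
- by move=> x; exact: integral_ge0.
apply: eq_integral => x _.
rewrite -(IH (fun i => s (lift ord0 i)) (fun t => g (tcons (s ord0 x, t))))//.
- apply: eq_integral => t _; congr g; apply: eq_from_tnth => i.
  rewrite tnth_mktuple; case: (unliftP ord0 i) => [j|] ->.
    by rewrite !tnthS tnth_mktuple.
  by rewrite !tnth0.
- by move=> i h mh h0; exact: muS.
- exact: measurableT_comp mgc _.
Qed.

End power_measure_theory.

(** * Lebesgue measure on R^n and on the half space *)

Section lebesgue_rV_theory.
Import numFieldNormedType.Exports.
Local Open Scope classical_set_scope.
Context (R : realType) (n : nat).
Implicit Types x z : 'rV[R]_n.

Lemma measurable_rV_coord (i : 'I_n) : measurable_fun setT (@rV_coord R n i).
Proof.
move=> _ B mB; rewrite setTI; apply: sub_sigma_algebra.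
by rewrite -bigcup_seq; exists i; [exact: mem_index_enum|exists B; rewrite ?setTI].
Qed.

Lemma measurable_fun_rVP d (T : measurableType d) (f : T -> 'rV[R]_n) :
  (forall i, measurable_fun setT (fun t => rV_coord i (f t))) -> measurable_fun setT f.
Proof.
move=> mf.
rewrite (_ : f = @rV_of_tuple R n \o (fun t => [tuple rV_coord i (f t) | i < n])).
  apply: measurableT_comp; first exact: measurable_rV_of_tuple.
  apply/measurable_fun_tnthP => i.
  rewrite (_ : _ \o _ = fun t => rV_coord i (f t))//.
  by apply/funext => t /=; rewrite tnth_mktuple.
by apply/funext => t /=; apply/rowP => i; rewrite mxE tnth_mktuple.
Qed.

Lemma measurable_rVB d (T : measurableType d) (f g : T -> 'rV[R]_n) :
  measurable_fun setT f -> measurable_fun setT g -> measurable_fun setT (fun t => f t - g t).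
Proof.
move=> mf mg; apply: measurable_fun_rVP => i.
rewrite (_ : (fun _ => _) = (fun t => rV_coord i (f t) - rV_coord i (g t))).
  by apply: measurable_funB; apply: measurableT_comp => //; exact: measurable_rV_coord.
by apply/funext => t; rewrite /rV_coord !mxE.
Qed.

Lemma measurable_enorm : measurable_fun setT (@enorm R n).
Proof.
apply: (@measurableT_comp _ _ _ _ _ _ (@Num.sqrt R)).
  exact: (continuous_measurable_fun (@sqrt_continuous R)).
apply: measurable_sum => i; apply: measurable_funX.
exact: measurable_rV_coord.
Qed.

Lemma enormN x : enorm (- x) = enorm x.
Proof. by congr Num.sqrt; apply: eq_bigr => i _; rewrite mxE sqrrN. Qed.

Lemma enorm_ge0 x : 0 <= enorm x.
Proof. exact: sqrtr_ge0. Qed.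

Local Open Scope ereal_scope.

Lemma integral_leb (g : 'rV[R]_n -> \bar R) :
  measurable_fun setT g -> (forall x, 0 <= g x) ->
  \int[leb R n]_x g x =
  \int[power_measure (@lebesgue_measure R) n]_t g (rV_of_tuple t).
Proof.
move=> mg g0.
transitivity (\int[pushforward (power_measure (@lebesgue_measure R) n)
  (@rV_of_tuple R n)]_x g x) => //.
by rewrite ge0_integral_pushforward//; exact: measurable_rV_of_tuple.
Qed.

Lemma integral_lebesgue_reflect (c : R) (h : R -> \bar R) :
  measurable_fun setT h -> (forall u, 0 <= h u) ->
  \int[@lebesgue_measure R]_u h (c - u)%R = \int[@lebesgue_measure R]_u h u.
Proof.
move=> mh h0.
pose phi := (fun u => c - u)%R : measurableTypeR R -> measurableTypeR R.
have mphi : measurable_fun setT phi by exact: measurable_funB.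
pose Phi : {mfun _ >-> _} := HB.pack phi (isMeasurableFun.Build _ _ _ _ _ mphi).
have <- : \int[pushforward (@lebesgue_measure R) Phi]_u h u =
    \int[@lebesgue_measure R]_u h (c - u)%R.
  by rewrite ge0_integral_pushforward.
apply: eq_measure_integral => /= A mA _.
apply/esym/lebesgue_measure_unique => //= _ [[a b]] _ <-.
rewrite /pushforward.
rewrite (_ : _ @^-1` _ = `[c - b, c - a[%classic)%R; last first.
  apply/seteqP; split => u; rewrite /= !in_itv/= /phi; lra.
rewrite !lebesgue_measure_itv/= !lte_fin.
rewrite ltrD2l ltrN2; case: ifPn => // ab.
by rewrite -!EFinB; congr EFin; ring.
Qed.

Lemma measurable_dilate (l : R) (Q : cube R n) : measurable (dilate l Q).
Proof.
rewrite (_ : dilate l Q = \bigcap_(i in [set: 'I_n]) (@rV_coord R n i @^-1`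
    [set u | `|u - cube_center Q ord0 i| <= l * cube_side Q / 2])%R).
  apply: fin_bigcap_measurable => // i _; rewrite -[X in measurable X]setTI.
  apply: measurable_rV_coord => //.
  rewrite (_ : [set u | _] = `[cube_center Q ord0 i - l * cube_side Q / 2,
    cube_center Q ord0 i + l * cube_side Q / 2]%classic)%R//.
  by apply/seteqP; split => u; rewrite /= in_itv/= ler_distl; lra.
by apply/seteqP; split => t /= At i => [_|]; exact: At.
Qed.

Lemma leb_dilate (l : R) (Q : cube R n) : (0 <= l)%R ->
  leb R n (dilate l Q) = ((l * cube_side Q) ^+ n)%:E.
Proof.
move=> l0.
pose A i := `[cube_center Q ord0 i - l * cube_side Q / 2,
  cube_center Q ord0 i + l * cube_side Q / 2]%classic%R : set (measurableTypeR R).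
transitivity (power_measure (@lebesgue_measure R) n [set t | forall i, A i (tnth t i)]).
  congr (power_measure _ _ _); apply/seteqP; split => t /= tA i; have := tA i;
    rewrite /A/= !mxE in_itv/= ler_distl; lra.
rewrite power_measure_box; last by move=> i; exact: measurable_itv.
have s0 : (0 <= l * cube_side Q)%R by rewrite mulr_ge0// ltW// cube_side_gt0.
have muA i : lebesgue_measure (A i) = (l * cube_side Q)%:E.
  rewrite lebesgue_measure_itv/= lte_fin.
  by case: ifPn => [_|]; [rewrite -EFinB|rewrite -leNgt => ?]; congr EFin; lra.
rewrite (eq_bigr (fun=> (l * cube_side Q)%:E)) => [|i _]; last exact: muA.
by rewrite prodEFin prodr_const card_ord.
Qed.

Lemma integral_leb_reflect x (g : 'rV[R]_n -> \bar R) :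
  measurable_fun setT g -> (forall z, 0 <= g z) ->
  \int[leb R n]_z g (x - z)%R = \int[leb R n]_z g z.
Proof.
move=> mg g0.
have mgx : measurable_fun setT (fun z => g (x - z)%R).
  by apply: measurableT_comp mg _; exact: measurable_rVB.
rewrite !integral_leb//.
rewrite -[RHS](@integral_power_measure_map _ _ _ (@lebesgue_measure R) n
  (fun i (u : measurableTypeR R) => (x ord0 i - u)%R : measurableTypeR R)).
- apply: eq_integral => t _; congr g; apply/rowP => i.
  by rewrite !mxE tnth_mktuple.
- by move=> i; exact: measurable_funB.
- by move=> i h mh h0; exact: integral_lebesgue_reflect.
- exact: measurableT_comp mg (@measurable_rV_of_tuple _ _).
- by [].
Qed.

Local Notation half := (@upper_half_space R n).
Local Notation mu := (leb_half_space R n).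
(** The change of variables that relates the values of T_t at z and at x - z. *)
Definition reflected x (p : 'rV[R]_n * measurableTypeR R) : 'rV[R]_n * measurableTypeR R :=
  ((x - p.1)%R, p.2).

Lemma measurable_reflected x : measurable_fun setT (reflected x).
Proof.
apply: measurable_fun_pair => //=; apply: measurable_rVB => //; exact: measurable_fst.
Qed.

Lemma measurable_snd_gt0 d (X : measurableType d) :
  measurable [set q : X * measurableTypeR R | (0 < q.2)%R].
Proof.
rewrite (_ : [set _ | _] = snd @^-1` `]0%R, +oo[%classic).
  rewrite -[X in measurable X]setTI.
  exact: (@measurable_snd _ _ X (measurableTypeR R)).
by apply/seteqP; split => p; rewrite /= in_itv/= andbT.
Qed.

Lemma measurable_upper_half_space : measurable (half : set ('rV[R]_n * measurableTypeR R)).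
Proof. exact: measurable_snd_gt0. Qed.

Lemma integral_reflectedT x (g : 'rV[R]_n * measurableTypeR R -> \bar R) :
  measurable_fun setT g -> (forall p, 0 <= g p) ->
  \int[mu]_p g (reflected x p) = \int[mu]_p g p.
Proof.
move=> mg g0.
rewrite (fubini_tonelli2 (g \o reflected x))//=; last first.
  exact: measurableT_comp mg (measurable_reflected x).
rewrite (fubini_tonelli2 g mg g0); apply: eq_integral => t _.
apply: (integral_leb_reflect x (g := fun z => g (z, t))) => //.
exact: measurableT_comp mg _.
Qed.

Lemma integral_reflected x (g : 'rV[R]_n * measurableTypeR R -> \bar R) :
  measurable_fun half g -> (forall p, half p -> 0 <= g p) ->
  \int[mu]_(p in half) g (reflected x p) = \int[mu]_(p in half) g p.
Proof.
move=> mg g0; rewrite integral_mkcond [RHS]integral_mkcond.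
rewrite -[RHS](integral_reflectedT x)//.
- exact/(measurable_restrictT _ measurable_upper_half_space).
- by move=> p; apply: erestrict_ge0.
Qed.

Lemma ae_reflected x (P : 'rV[R]_n * measurableTypeR R -> Prop) :
  {ae mu, forall p, P p} -> {ae mu, forall p, P (reflected x p)}.
Proof.
move=> [N [mN N0 PN]]; exists (reflected x @^-1` N); split.
- by rewrite -[X in measurable X]setTI; exact: measurable_reflected.
- rewrite -N0 -[X in _ X = _]setIT -[X in _ = _ X]setIT.
  rewrite -!(integral_indic _ measurableT)//; last first.
    by rewrite -[X in measurable X]setTI; exact: measurable_reflected.
  rewrite -[RHS](integral_reflectedT x)//.
  by apply/measurable_EFinP; exact: measurable_indic.
- by move=> p /= nP; exact: PN.
Qed.

End lebesgue_rV_theory.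

(** * Hoelder's inequality on the annuli *)

Section annulus_mean_theory.
Import numFieldNormedType.Exports.
Local Open Scope classical_set_scope.
Context (R : realType).

Lemma normc_sqrtE (z : R[i]) : normc z = Num.sqrt (complex.Re z ^+ 2 + complex.Im z ^+ 2).
Proof. by case: z. Qed.

Lemma normc_ge0 (z : R[i]) : 0 <= normc z.
Proof. by rewrite normc_sqrtE sqrtr_ge0. Qed.

Lemma measurable_normc d (T : measurableType d) D (f : T -> R[i]) :
  cmeasurable_fun D f -> measurable_fun D (fun x => normc (f x)).
Proof.
move=> [mRe mIm]; under eq_fun do rewrite normc_sqrtE.
apply: (@measurableT_comp _ _ _ _ _ _ (@Num.sqrt R)).
  exact: (continuous_measurable_fun (@sqrt_continuous R)).
by apply: measurable_funD; exact: measurable_funX.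
Qed.

Local Open Scope ereal_scope.

Lemma prode_poweR (I : Type) (s : seq I) (F : I -> \bar R) (p : R) :
  (forall i, 0 <= F i) ->
  \prod_(i <- s) F i `^ p = (\prod_(i <- s) F i) `^ p.
Proof.
move=> F0; elim: s => [|i s IH]; first by rewrite !big_nil poweR1r.
by rewrite !big_cons poweRM ?prode_ge0// IH.
Qed.

Context (n m : nat).
Local Notation Rn := 'rV[R]_n.
Local Notation Rnm := (m.-tuple 'rV[R]_n).

Lemma measurable_power_set (A : set Rn) : measurable A -> measurable (@power_set R n m A).
Proof. by move=> mA; apply: (measurable_box (A := fun=> A)). Qed.

Lemma measurable_annulus j (Q : cube R n) : measurable (@annulus R n m j Q).
Proof.
by apply: measurableD; apply: measurable_power_set; exact: measurable_dilate.
Qed.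

Lemma vol_dilate (l : R) (Q : cube R n) : (0 <= l)%R ->
  vol (dilate l Q) = ((l * cube_side Q) ^+ n)%R.
Proof. by move=> l0; rewrite /vol leb_dilate. Qed.

Lemma vol_dilate_gt0 (l : R) (Q : cube R n) : (0 < l)%R -> (0 < vol (dilate l Q))%R.
Proof. by move=> l0; rewrite vol_dilate ?ltW// exprn_gt0// mulr_gt0// cube_side_gt0. Qed.

Lemma average_ge0 r f (A : set Rn) : 0 <= average r f A.
Proof. exact: poweR_ge0. Qed.

Lemma leb_m_gt0 : 0 < leb_m R n m [set: Rnm].
Proof.
pose Q : cube R n := Cube 0 (@ltr01 R).
have mQ : measurable (dilate 1 Q) by exact: measurable_dilate.
apply: (@lt_le_trans _ _ (leb_m R n m (@power_set R n m (dilate 1 Q)))).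
  rewrite [X in 0 < X](@power_measure_box _ _ _ (leb R n) m (fun=> dilate 1 Q))//.
  under eq_bigr do rewrite leb_dilate//.
  by rewrite prodEFin lte_fin prodr_const exprn_gt0// exprn_gt0// mulr_gt0// cube_side_gt0.
by apply: le_measure; rewrite ?inE//; exact: measurable_power_set.
Qed.

(** The annulus is part of the m-fold power of the dilate 2^j Q, so Hoelder's
    inequality leaves the L^r norm of prod f_i over that power, which factors by
    Tonelli's theorem. Since 1/r + 1/r' = 1, the powers of |2^j Q| that normalize
    the means cancel the factor |2^j Q|^m exactly. *)
Lemma annulus_hoelder (r : R) j (Q : cube R n) (N : Rnm -> \bar R)
    (f : 'I_m -> Rn -> R[i]) : (1 <= r)%R ->
  measurable_fun setT N -> (forall y, 0 <= N y) -> vLr r f ->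
  \int[leb_m R n m]_(y in @annulus R n m j Q)
     (N y * (\prod_(i < m) normc (f i (tnth y i)))%:E) <=
  (vol (dilate (2 ^+ j) Q) ^+ m)%:E * annulus_mean r j Q N *
  \prod_(i < m) average r (f i) (dilate (2 ^+ j) Q).
Proof.
move=> r1 mN N0 fL.
set A := @annulus R n m j Q; set B := dilate (2 ^+ j) Q.
have mA : measurable A by exact: measurable_annulus.
have mB : measurable B by exact: measurable_dilate.
have r0 : (0 < r)%R by exact: lt_le_trans r1.
have a0 : (0 < vol B)%R by apply: vol_dilate_gt0; rewrite exprn_gt0.
pose b := ((vol B ^+ m)^-1)%R.
have b0 : (0 < b)%R by rewrite invr_gt0 exprn_gt0.
pose h i u := (normc (f i u) * \1_B u)%R.
have h0 i u : (0 <= h i u)%R by rewrite mulr_ge0 ?normc_ge0.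
have mh i : measurable_fun setT (h i).
  apply: measurable_funM; last exact: measurable_indic.
  by apply: measurable_normc; exact: (fL i).1.
pose G y := (\prod_(i < m) h i (tnth y i))%R.
have G0 y : (0 <= G y)%R by exact: prodr_ge0.
have mG : measurable_fun setT G.
  apply/measurable_EFinP.
  rewrite (_ : _ \o _ = fun y => \prod_(i < m) (EFin \o h i) (tnth y i)).
    by apply: (measurable_prod_tnth (f := fun i => EFin \o h i)) => i; exact/measurable_EFinP.
  by apply/funext => y /=; rewrite prodEFin.
pose NA := N \_ A.
have NA0 y : 0 <= NA y by exact: erestrict_ge0.
have mNA : measurable_fun setT NA.
  by apply/(measurable_restrictT _ mA); exact: measurable_funTS.
pose Y i := \int[leb R n]_(u in B) (normc (f i u) `^ r)%:E.
have Y0 i : 0 <= Y i by apply: integral_ge0 => u _; rewrite lee_fin powR_ge0.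
have intG : \int[leb_m R n m]_y (G y `^ r)%:E = \prod_(i < m) Y i.
  transitivity (\int[leb_m R n m]_y \prod_(i < m) (h i (tnth y i) `^ r)%:E).
    apply: eq_integral => y _; rewrite -poweR_EFin -prodEFin -prode_poweR// => i.
    by rewrite lee_fin.
  rewrite (integral_power_measure_prod (leb R n) (f := fun i u => (h i u `^ r)%:E)); last 2 first.
  - move=> i; apply/measurable_EFinP.
    by apply: (@measurableT_comp _ _ _ _ _ _ (@powR R ^~ r)) => //; exact: measurable_powR.
  - by move=> i u; rewrite lee_fin powR_ge0.
  apply: eq_bigr => i _; rewrite /Y [RHS]integral_mkcond.
  apply: eq_integral => u _; rewrite /h indicE patchE.
  by case: (u \in B); rewrite ?mulr1// mulr0 powR0// gt_eqF.
have LE : \int[leb_m R n m]_(y in A) (N y * (\prod_(i < m) normc (f i (tnth y i)))%:E) =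
    \int[leb_m R n m]_y (NA y * (G y)%:E).
  rewrite integral_mkcond; apply: eq_integral => y _; rewrite /NA !patchE.
  case: ifPn; last by rewrite mul0e.
  rewrite inE => -[Ay _]; congr (_ * _%:E); apply: eq_bigr => i _.
  by rewrite /h indicE mem_set ?mulr1//; exact: Ay.
have avgE : \prod_(i < m) average r (f i) B = (b%:E * \prod_(i < m) Y i) `^ r^-1.
  rewrite prode_poweR; last first.
    by move=> i; apply: mule_ge0; [rewrite lee_fin invr_ge0 ltW|exact: Y0].
  rewrite big_split/= prodEFin prodr_const card_ord.
  by rewrite exprVn.
have vb : (vol B ^+ m)%R = (b^-1)%R by rewrite invrK.
rewrite LE avgE vb /annulus_mean -/A -/B -/NA -/b.
have PY0 : 0 <= \prod_(i < m) Y i by exact: prode_ge0.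
(* for r = 1 the mean is an essential supremum, bounding N almost everywhere *)
case: eqP => [r_eq1|/eqP r_neq1].
  rewrite (_ : r^-1 = 1)%R; last by rewrite r_eq1 invr1.
  rewrite poweRe1; last by apply: mule_ge0 => //; rewrite lee_fin ltW.
  rewrite -intG r_eq1.
  set M := ess_sup _ _.
  have M0 : 0 <= M by apply: ess_sup_gee; [exact: leb_m_gt0|apply: aeW => y; exact: NA0].
  rewrite [leRHS](_ : _ = M * \int[leb_m R n m]_y (G y)%:E).
    rewrite -ge0_integralZl//; last 2 first.
    - exact/measurable_EFinP.
    - by move=> y _; rewrite lee_fin.
    apply: ae_le_integral_nomeas => //.
    - by move=> y _; rewrite mule_ge0// lee_fin.
    - by move=> y _; rewrite mule_ge0// lee_fin.
    - have := ess_sup_ge (leb_m R n m) NA; apply: filterS => y yM _.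
      by rewrite lee_wpmul2r// lee_fin.
  rewrite (eq_integral (fun y => (G y)%:E)); last by move=> y _; rewrite powRr1.
  by rewrite muleACA -EFinM mulVf ?gt_eqF// mul1e.
have r'0 : (0 < r / (r - 1))%R.
  by rewrite divr_gt0// subr_gt0 lt_neqAle eq_sym r_neq1.
have rr' : ((r / (r - 1))^-1 + r^-1 = 1)%R.
  by rewrite invf_div; field; rewrite gt_eqF.
have := hoelder_ereal (leb_m R n m) mNA mG NA0 G0 r'0 r0 rr'.
rewrite intG => /le_trans; apply.
rewrite (_ : \int[leb_m R n m]_y (NA y `^ (r / (r - 1))) =
    \int[leb_m R n m]_(y in A) (N y `^ (r / (r - 1)))); last first.
  rewrite [RHS]integral_mkcond; apply: eq_integral => y _; rewrite /NA !patchE.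
  by case: ifPn => // _; rewrite poweR0r// gt_eqF.
set X := \int[_]_(y in A) _.
have X0 : 0 <= X by apply: integral_ge0 => y _; exact: poweR_ge0.
rewrite !poweRM// ?lee_fin ?(ltW b0)//.
set s' := ((r / (r - 1))^-1)%R in rr' *.
rewrite [leRHS](_ : _ = (b^-1)%:E * (b%:E `^ s' * b%:E `^ r^-1) *
   (X `^ s' * (\prod_(i < m) Y i) `^ r^-1)); last first.
  by rewrite -!muleA; do 2 congr (_ * _); rewrite muleCA.
rewrite -poweRD; last by rewrite add_neq0_poweRD_def// rr' oner_neq0.
by rewrite rr' poweRe1 ?lee_fin ?(ltW b0)// -EFinM mulVf ?gt_eqF// mul1e.
Qed.

End annulus_mean_theory.

(** * Integrals of complex valued functions *)

Section complex_integral_theory.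
Import numFieldNormedType.Exports.
Local Open Scope classical_set_scope.
Local Open Scope complex_scope.
Context d (T : measurableType d) (R : realType).
Variable mu : {measure set T -> \bar R}.
Implicit Types f g : T -> R[i].

Lemma cintegrable0 : cintegrable mu (fun=> 0 : R[i]).
Proof. by split; apply: integrable0. Qed.

Lemma cintegral0 : cintegral mu (fun=> 0 : R[i]) = 0.
Proof. by rewrite /cintegral /Rintegral/= !integral0. Qed.

Lemma cintegrableD f g : cintegrable mu f -> cintegrable mu g ->
  cintegrable mu (fun x => f x + g x).
Proof.
move=> [f1 f2] [g1 g2]; split.
  apply: (eq_integrable measurableT) (integrableD measurableT f1 g1) => x _ /=.
  by case: (f x) (g x) => a b [c e].
apply: (eq_integrable measurableT) (integrableD measurableT f2 g2) => x _ /=.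
by case: (f x) (g x) => a b [c e].
Qed.

Lemma cintegralD f g : cintegrable mu f -> cintegrable mu g ->
  cintegral mu (fun x => f x + g x) = cintegral mu f + cintegral mu g.
Proof.
move=> [f1 f2] [g1 g2]; rewrite /cintegral /GRing.add/=; congr (_ +i* _).
  rewrite -RintegralD//; apply: eq_Rintegral => x _.
  by case: (f x) (g x) => a b [c e].
rewrite -RintegralD//; apply: eq_Rintegral => x _.
by case: (f x) (g x) => a b [c e].
Qed.

Lemma ReZ (a : R) (z : R[i]) : complex.Re (a%:C * z) = a * complex.Re z.
Proof. by case: z => u v /=; rewrite mul0r subr0. Qed.

Lemma ImZ (a : R) (z : R[i]) : complex.Im (a%:C * z) = a * complex.Im z.
Proof. by case: z => u v /=; rewrite mul0r addr0. Qed.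

Lemma cintegrableZ (c : R[i]) f : cintegrable mu f -> cintegrable mu (fun x => c * f x).
Proof.
case: c => u v [f1 f2]; split.
  apply: (eq_integrable measurableT) (integrableB measurableT
    (integrableZl measurableT u f1) (integrableZl measurableT v f2)) => x _ /=.
  by case: (f x).
apply: (eq_integrable measurableT)
  (integrableD measurableT (integrableZl measurableT u f2)
    (integrableZl measurableT v f1)) => x _ /=.
by case: (f x) => p q /=; rewrite -!EFinM -EFinD.
Qed.

Lemma cintegralZ (c : R[i]) f : cintegrable mu f ->
  cintegral mu (fun x => c * f x) = c * cintegral mu f.
Proof.
case: c => u v [f1 f2].
have Z (k : R) (g : T -> R) : mu.-integrable setT (EFin \o g) ->
    mu.-integrable setT (EFin \o (fun x => k * g x)).
  by move=> /(integrableZl measurableT k).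
rewrite /cintegral [RHS]/(_ * _)/=; congr (_ +i* _).
  rewrite -!RintegralZl// -RintegralB//; [|exact: Z|exact: Z].
  by apply: eq_Rintegral => x _; case: (f x).
rewrite -!RintegralZl// -RintegralD//; [|exact: Z|exact: Z].
by apply: eq_Rintegral => x _; case: (f x).
Qed.

Lemma cintegrableB f g : cintegrable mu f -> cintegrable mu g ->
  cintegrable mu (fun x => f x - g x).
Proof.
move=> If Ig; under eq_fun do rewrite -mulN1r.
exact/cintegrableD/cintegrableZ.
Qed.

Lemma cintegralB f g : cintegrable mu f -> cintegrable mu g ->
  cintegral mu (fun x => f x - g x) = cintegral mu f - cintegral mu g.
Proof.
move=> If Ig; rewrite -[in RHS]mulN1r -cintegralZ// -cintegralD//; last exact: cintegrableZ.
by congr cintegral; apply/funext => x; rewrite mulN1r.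
Qed.

Lemma normc_le_Re_Im (z : R[i]) : normc z <= `|complex.Re z| + `|complex.Im z|.
Proof.
rewrite normc_sqrtE -[leRHS]ger0_norm ?addr_ge0// -sqrtr_sqr ler_wsqrtr//.
rewrite sqrrD !real_normK ?num_real// lerD2r lerDl mulrn_wge0// mulr_ge0//.
Qed.

Lemma Re_le_normc (z : R[i]) : `|complex.Re z| <= normc z.
Proof. by rewrite normc_sqrtE -sqrtr_sqr ler_wsqrtr// lerDl sqr_ge0. Qed.

Lemma Im_le_normc (z : R[i]) : `|complex.Im z| <= normc z.
Proof. by rewrite normc_sqrtE -sqrtr_sqr ler_wsqrtr// lerDr sqr_ge0. Qed.

Local Open Scope ereal_scope.

(** The factor 2 comes from estimating the real and the imaginary part
    separately. *)
Lemma normc_cintegral_le f : cintegrable mu f ->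
  (normc (cintegral mu f))%:E <= \int[mu]_x (2 * normc (f x))%:E.
Proof.
move=> [f1 f2].
have n0 x : (0 <= normc (f x))%R by exact: normc_ge0.
have mf : measurable_fun setT (fun x => normc (f x)).
  by apply: measurable_normc; split; apply/measurable_EFinP;
    [exact: (measurable_int _ f1)|exact: (measurable_int _ f2)].
have part (p : R[i] -> R) : (forall z, `|p z| <= normc z)%R ->
    mu.-integrable setT (fun x => (p (f x))%:E) ->
    (`|\int[mu]_x p (f x)|%R)%:E <= \int[mu]_x (normc (f x))%:E.
  move=> pn pf; rewrite /Rintegral -abse_EFin fineK; last exact: integrable_fin_num.
  apply: (le_trans (le_abse_integral _ _ _)) => //; first exact: measurable_int pf.
  apply: ae_le_integral_nomeas => // [x _|]; first by rewrite lee_fin.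
  by apply: aeW => x _; rewrite /= lee_fin.
have -> : \int[mu]_x (2 * normc (f x))%:E =
    \int[mu]_x (normc (f x))%:E + \int[mu]_x (normc (f x))%:E.
  rewrite -ge0_integralD//; try by [exact/measurable_EFinP|move=> x _; rewrite lee_fin].
  by apply: eq_integral => x _; rewrite -EFinD mulr2n mulrDl !mul1r.
apply: (@le_trans _ _ (`|complex.Re (cintegral mu f)| + `|complex.Im (cintegral mu f)|)%:E).
  by rewrite lee_fin normc_le_Re_Im.
by rewrite EFinD leeD//; apply: part => // z; [exact: Re_le_normc|exact: Im_le_normc].
Qed.

End complex_integral_theory.

(** * Weighted L^2 norms *)

Section weighted_norm.
Import numFieldNormedType.Exports.
Local Open Scope classical_set_scope.
Local Open Scope ereal_scope.
Context dY dW (Y : measurableType dY) (W : measurableType dW) (R : realType).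
Variables (mu : {sigma_finite_measure set Y -> \bar R})
  (nu : {sigma_finite_measure set W -> \bar R}) (D : set W) (w : W -> R).
Hypotheses (mD : measurable D) (mw : measurable_fun D w)
  (w0 : forall o, D o -> (0 <= w o)%R).

Definition weighted_norm (F : W -> R[i]) : \bar R :=
  (\int[nu]_(o in D) (normc (F o) ^+ 2 * w o)%:E) `^ 2^-1.

Lemma weighted_norm_ge0 F : 0 <= weighted_norm F.
Proof. exact: poweR_ge0. Qed.

Lemma le_weighted_norm F G : {ae nu, forall o, D o -> F o = G o} ->
  weighted_norm F <= weighted_norm G.
Proof.
move=> FG.
have ge0 (H : W -> R[i]) o : D o -> 0 <= (normc (H o) ^+ 2 * w o)%:E.
  by move=> Do; rewrite lee_fin mulr_ge0 ?sqr_ge0// w0.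
apply: gt0_ler_poweR; rewrite ?in_itv/= ?leey ?andbT; [by []| | |].
- by apply: integral_ge0 => o Do; exact: ge0.
- by apply: integral_ge0 => o Do; exact: ge0.
apply: ae_le_integral_nomeas => //; [exact: ge0|exact: ge0|].
by apply: filterS FG => o FGo Do; rewrite FGo.
Qed.

Lemma eq_weighted_norm F G : {ae nu, forall o, D o -> F o = G o} ->
  weighted_norm F = weighted_norm G.
Proof.
move=> FG; apply/eqP; rewrite eq_le !le_weighted_norm//.
by apply: filterS FG => o FGo Do; rewrite FGo.
Qed.

Let mYD : measurable ([set: Y] `*` D).
Proof. exact: measurableX. Qed.

Let measurable_density (H : Y -> W -> R[i]) :
  measurable_fun ([set: Y] `*` D) (fun p => normc (H p.1 p.2)) ->
  measurable_fun setT
    ((fun p => (normc (H p.1 p.2) ^+ 2 * w p.2)%:E) \_ ([set: Y] `*` D)).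
Proof.
move=> mH; apply/(measurable_restrictT _ mYD)/measurable_EFinP.
apply: measurable_funM; first exact: measurable_funX.
apply: (measurable_comp mD) => //; last exact: measurable_funTS.
by move=> _ [p [_ Dp] <-].
Qed.

Let integral_density (H : Y -> W -> R[i]) y :
  \int[nu]_(o in D) (normc (H y o) ^+ 2 * w o)%:E =
  \int[nu]_o ((fun p => (normc (H p.1 p.2) ^+ 2 * w p.2)%:E) \_ ([set: Y] `*` D)) (y, o).
Proof.
rewrite integral_mkcond; apply: eq_integral => o _; rewrite !patchE in_setX/=.
by rewrite in_setT.
Qed.

Let density_ge0 (H : Y -> W -> R[i]) p :
  0 <= ((fun p => (normc (H p.1 p.2) ^+ 2 * w p.2)%:E) \_ ([set: Y] `*` D)) p.
Proof.
by apply: erestrict_ge0 => -[y o] /= [_ Do]; rewrite lee_fin mulr_ge0 ?sqr_ge0// w0.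
Qed.

Lemma measurable_weighted_norm (H : Y -> W -> R[i]) :
  measurable_fun ([set: Y] `*` D) (fun p => normc (H p.1 p.2)) ->
  measurable_fun setT (fun y => weighted_norm (H y)).
Proof.
move=> mH; apply: (measurableT_comp (measurable_poweR _)) => //.
under eq_fun do rewrite integral_density.
exact: (measurable_fun_fubini_tonelli_F _ (measurable_density mH)).
Qed.

(** A bound on the operator [U] is reduced here to the norms of its kernel [H],
    by Minkowski's integral inequality; the factor 2 is that of
    [normc_cintegral_le]. *)
Lemma weighted_norm_cintegral (H : Y -> W -> R[i]) (Phi : Y -> R[i]) (U : W -> R[i]) :
  measurable_fun ([set: Y] `*` D) (fun p => normc (H p.1 p.2)) ->
  measurable_fun setT (fun y => normc (Phi y)) ->
  {ae nu, forall o, D o -> cintegrable mu (fun y => H y o * Phi y)%R /\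
    U o = cintegral mu (fun y => H y o * Phi y)%R} ->
  weighted_norm U <= 2%:E * \int[mu]_y (weighted_norm (H y) * (normc (Phi y))%:E).
Proof.
move=> mH mPhi UE.
(* the square root of the density turns the weighted norm into an L^2(nu) norm *)
pose F : Y * W -> R :=
  (fun p => 2 * normc (H p.1 p.2) * normc (Phi p.1) * Num.sqrt (w p.2))%R
  \_ ([set: Y] `*` D).
have F0 p : (0 <= F p)%R.
  by rewrite /F patchE; case: ifP => // _; rewrite !mulr_ge0// normc_ge0.
have mF : measurable_fun setT F.
  apply/(measurable_restrictT _ mYD); apply: measurable_funM; last first.
    apply: (@measurableT_comp _ _ _ _ _ _ (@Num.sqrt R)).
      exact: (continuous_measurable_fun (@sqrt_continuous R)).
    apply: (measurable_comp mD) => //; last exact: measurable_funTS.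
    by move=> _ [p [_ Dp] <-].
  apply: measurable_funM; first exact: measurable_funM.
  by apply: measurable_funTS; apply: measurableT_comp mPhi _.
apply: (@le_trans _ _ ((\int[nu]_o ((\int[mu]_y (F (y, o))%:E) ^+ 2)) `^ 2^-1)).
  have sq0 (u : \bar R) : 0 <= u -> 0 <= u ^+ 2 by move=> ?; rewrite expe2 mule_ge0.
  have I0 o : 0 <= \int[mu]_y (F (y, o))%:E.
    by apply: integral_ge0 => y _; rewrite lee_fin.
  apply: gt0_ler_poweR; rewrite ?in_itv/= ?leey ?andbT//.
  - by apply: integral_ge0 => o Do; rewrite lee_fin mulr_ge0 ?sqr_ge0// w0.
  - by apply: integral_ge0 => o _; exact: sq0.
  rewrite integral_mkcond; apply: ae_le_integral_nomeas => //.
  - move=> o _; apply: erestrict_ge0 => {}o Do.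
    by rewrite lee_fin mulr_ge0 ?sqr_ge0// w0.
  - by move=> o _; exact: sq0.
  apply: filterS UE => o Uo _; rewrite patchE; case: ifPn => [|_]; last exact: sq0.
  rewrite inE => Do; have [iU ->] := Uo Do.
  have FE y : (F (y, o))%:E = (Num.sqrt (w o))%:E * (2 * normc (H y o * Phi y))%:E.
    rewrite /F patchE mem_set//= -EFinM ComplexField.Normc.normcM; congr EFin; ring.
  under eq_integral do rewrite FE.
  have cH0 y : (0 <= 2 * normc (H y o * Phi y))%R by rewrite mulr_ge0// normc_ge0.
  have mHP : measurable_fun setT (fun y => 2 * normc (H y o * Phi y))%R.
    apply: measurable_funM => //; apply: measurable_normc; split; apply/measurable_EFinP;
      [exact: (measurable_int _ iU.1)|exact: (measurable_int _ iU.2)].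
  rewrite ge0_integralZl_EFin ?sqrtr_ge0//; last 2 first.
  - by move=> y _; rewrite lee_fin.
  - exact/measurable_EFinP.
  rewrite muleACA -EFinM -expr2 (sqr_sqrtr (w0 Do)).
  rewrite mulrC EFinM.
  apply: lee_wpmul2l; first by rewrite lee_fin w0.
  by rewrite expr2 EFinM lee_pmul ?lee_fin ?normc_ge0//; exact: normc_cintegral_le.
apply: (le_trans (integral_minkowski_L2 mu nu mF F0)).
rewrite -ge0_integralZl_EFin//; last 2 first.
- by move=> y _; rewrite mule_ge0 ?weighted_norm_ge0// lee_fin normc_ge0.
- by apply: emeasurable_funM; [exact: measurable_weighted_norm|exact/measurable_EFinP].
rewrite le_eqVlt; apply/orP; left; apply/eqP; apply: eq_integral => y _.
have c0 : (0 <= 2 * normc (Phi y))%R by rewrite mulr_ge0// normc_ge0.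
transitivity (((2 * normc (Phi y)) ^+ 2)%:E `^ 2^-1 * weighted_norm (H y)).
  rewrite /weighted_norm -poweRM ?lee_fin ?sqr_ge0//; last first.
    by apply: integral_ge0 => o Do; rewrite lee_fin mulr_ge0 ?sqr_ge0// w0.
  congr (_ `^ _); rewrite integral_density -ge0_integralZl_EFin ?sqr_ge0//; last first.
    exact: measurableT_comp (measurable_density mH) _.
  apply: eq_integral => o _; rewrite /F !patchE in_setX/= in_setT/=.
  case: ifPn; last by rewrite mule0 expr0n.
  rewrite inE => Do; rewrite -EFinM; congr EFin.
  by rewrite 3!exprMn sqr_sqrtr ?w0//; ring.
rewrite poweR_EFin -powR_mulrn// -powRrM mulfV// powRr1// muleC EFinM.
by rewrite muleCA.
Qed.

End weighted_norm.

(** * Tensor products of restricted functions *)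

Section restriction.
Import numFieldNormedType.Exports.
Local Open Scope classical_set_scope.
Local Open Scope complex_scope.
Context (R : realType) (n m : nat).
Local Notation Rn := 'rV[R]_n.
Local Notation Rnm := (m.-tuple 'rV[R]_n).
Implicit Types (f : 'I_m -> Rn -> R[i]) (A B : set Rn).

Definition tensor f (y : Rnm) : R[i] := \prod_(i < m) f i (tnth y i).

Lemma normc_tensor f y : normc (tensor f y) = \prod_(i < m) normc (f i (tnth y i)).
Proof.
rewrite /tensor; elim: (index_enum _) => [|i s IH].
  by rewrite !big_nil ComplexField.Normc.normc1.
by rewrite !big_cons ComplexField.Normc.normcM IH.
Qed.

Lemma vrestrict_vrestrict f A B : A `<=` B ->
  vrestrict (vrestrict f B) A = vrestrict f A.
Proof.
move=> AB; apply/funext => i; apply/funext => x; rewrite /vrestrict !indicE.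
case: (boolP (x \in A)) => [|_]; last by rewrite !mul0r.
by rewrite inE => /AB Bx; rewrite mem_set// !mul1r.
Qed.

Lemma tensor_vrestrict f A y :
  tensor (vrestrict f A) y = (\1_(power_set A) y)%:C * tensor f y.
Proof.
rewrite indicE; case: (boolP (y \in _)) => [|yA].
  rewrite inE mul1r => Ay; apply: eq_bigr => i _.
  by rewrite /vrestrict indicE mem_set ?mul1r//; exact: Ay.
rewrite mul0r; apply/eqP; rewrite prodf_seq_eq0; apply/hasP.
move: yA; rewrite notin_setE => /= /existsNP[i Ayi].
by exists i; rewrite ?mem_index_enum//= /vrestrict indicE memNset// mul0r.
Qed.

Lemma Lr_restrict (r : R) (g : Rn -> R[i]) A : 0 < r -> measurable A -> Lr r g ->
  Lr r (fun x => (\1_A x)%:C * g x).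
Proof.
move=> r0 mA [[mRe mIm] gr].
have ReE x : complex.Re ((\1_A x)%:C * g x) = \1_A x * complex.Re (g x).
  by case: (g x) => a b /=; rewrite mul0r subr0.
have ImE x : complex.Im ((\1_A x)%:C * g x) = \1_A x * complex.Im (g x).
  by case: (g x) => a b /=; rewrite mul0r addr0.
split.
  split; [under eq_fun do rewrite ReE|under eq_fun do rewrite ImE];
    by apply: measurable_funM => //; exact: measurable_indic.
apply: le_lt_trans gr; apply: ae_le_integral_nomeas => //.
- by move=> x _; rewrite lee_fin powR_ge0.
- by move=> x _; rewrite lee_fin powR_ge0.
apply: aeW => x _; rewrite lee_fin ComplexField.Normc.normcM.
apply: ge0_ler_powR; rewrite ?nnegrE ?mulr_ge0 ?normc_ge0 ?(ltW r0)//.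
rewrite indicE; case: (_ \in _); rewrite ?ComplexField.Normc.normc1 ?mul1r//.
by rewrite ComplexField.Normc.normc0 mul0r normc_ge0.
Qed.

Lemma vLr_vrestrict (r : R) f A : 0 < r -> measurable A -> vLr r f -> vLr r (vrestrict f A).
Proof. by move=> r0 mA fL i; exact: Lr_restrict. Qed.

Lemma measurable_normc_tensor (r : R) f : vLr r f ->
  measurable_fun setT (fun y => normc (tensor f y)).
Proof.
move=> fL; under eq_fun do rewrite normc_tensor.
apply/measurable_EFinP.
rewrite (_ : _ \o _ = fun y => \prod_(i < m) (fun u => (normc (f i u))%:E) (tnth y i))%E.
  apply: (measurable_prod_tnth (f := fun i u => (normc (f i u))%:E)) => i.
  by apply/measurable_EFinP; apply: measurable_normc; exact: (fL i).1.
by apply/funext => y /=; rewrite prodEFin.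
Qed.

Lemma tensor_sub_vrestrict f A y :
  tensor f y - tensor (vrestrict f A) y = (\1_(~` power_set A) y)%:C * tensor f y.
Proof.
rewrite tensor_vrestrict -{1}(mul1r (tensor f y)) -mulrBl; congr (_ * _).
rewrite !indicE in_setC; case: (_ \in _); rewrite /= ?subr0 ?subrr//.
Qed.

Lemma normc_indicM (A' : set Rnm) (y : Rnm) (z : R[i]) :
  normc ((\1_A' y)%:C * z) = \1_A' y * normc z.
Proof.
rewrite ComplexField.Normc.normcM indicE; case: (_ \in _).
  by rewrite ComplexField.Normc.normc1.
by rewrite ComplexField.Normc.normc0.
Qed.

End restriction.

Lemma annulus_mean_ge0 (R : realType) (n m : nat) (r : R) j (Q : cube R n)
    (N : m.-tuple 'rV[R]_n -> \bar R) : (forall y, (0 <= N y)%E) ->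
  (0 <= annulus_mean r j Q N)%E.
Proof.
move=> N0; rewrite /annulus_mean; case: ifP => _; last exact: poweR_ge0.
apply: ess_sup_gee; first exact: leb_m_gt0.
by apply: aeW => y; exact: erestrict_ge0.
Qed.

Lemma lee_prod (R : realType) (I : Type) (s : seq I) (F G : I -> \bar R) :
  (forall i, (0 <= F i)%E) -> (forall i, (F i <= G i)%E) ->
  (\prod_(i <- s) F i <= \prod_(i <- s) G i)%E.
Proof.
move=> F0 FG; elim: s => [|i s IH]; first by rewrite !big_nil.
by rewrite !big_cons lee_pmul// prode_ge0.
Qed.

(** * Oscillation bounds from kernel conditions *)

Section bounded_oscillation_from_kernel.
Import numFieldNormedType.Exports.
Local Open Scope classical_set_scope.
Local Open Scope ereal_scope.
Context (R : realType) (n m : nat) dW (W : measurableType dW).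
Local Notation Rn := 'rV[R]_n.
Local Notation Rnm := (m.-tuple 'rV[R]_n).
Variables (nu : {sigma_finite_measure set W -> \bar R}) (D : set W) (w : W -> R).
Hypotheses (mD : measurable D) (mw : measurable_fun D w)
  (w0 : forall o, D o -> (0 <= w o)%R).
Variable r : R.
Hypothesis r1 : (1 <= r)%R.
Variables (KK : Rn -> Rnm -> W -> R[i]) (TT : ('I_m -> Rn -> R[i]) -> Rn -> W -> R[i]).
Local Notation normB := (weighted_norm nu D w).
Local Notation mu := (leb_m R n m).

Hypothesis mKK : forall x, cmeasurable_fun ([set: Rnm] `*` D) (fun p => KK x p.1 p.2).

(** The only link between operator and kernel that the oscillation bounds use. It
    is asked for almost every parameter, as the kernel representations behind
    S^(2) and S^(3) hold almost everywhere. *)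
Definition far_represented := forall f, vLr r f ->
  forall (Q : cube R n) x, cube_set Q x ->
  {ae nu, forall o, D o ->
    let k y := (KK x y o * (tensor f y - tensor (vrestrict f (star Q)) y))%R in
    cintegrable mu k /\
    (TT f x o - TT (vrestrict f (star Q)) x o)%R = cintegral mu k}.

Hypothesis far : far_represented.

Definition scale_cube (c : R) (c0 : (0 < c)%R) (Q : cube R n) : cube R n :=
  Cube (cube_center Q) (mulr_gt0 c0 (cube_side_gt0 Q)).

Lemma dilate_scale_cube l c (c0 : (0 < c)%R) Q :
  dilate l (scale_cube c0 Q) = dilate (l * c) Q.
Proof. by rewrite /dilate/= (mulrA l c). Qed.

Lemma subset_dilate l l' (Q : cube R n) : (l <= l')%R -> dilate l Q `<=` dilate l' Q.
Proof.
move=> ll x Qx i; apply: le_trans (Qx i) _.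
by rewrite ler_pM2r// ler_wpM2r// ltW// cube_side_gt0.
Qed.

Let r0 : (0 < r)%R. Proof. exact: lt_le_trans r1. Qed.


Lemma measurable_star (Q : cube R n) : measurable (star Q).
Proof. exact: measurable_dilate. Qed.

Let measurable_normc_KK x :
  measurable_fun ([set: Rnm] `*` D) (fun p => normc (KK x p.1 p.2)).
Proof. exact: measurable_normc. Qed.

Lemma proper_scale_cube2 (Q : cube R n) : (0 < n)%N ->
  cube_set Q `<` cube_set (scale_cube (ltr0Sn R 1) Q).
Proof.
move=> n0; have s0 := cube_side_gt0 Q; split.
  rewrite /cube_set dilate_scale_cube; apply: subset_dilate; lra.
move=> /(_ (\row_i (cube_center Q ord0 i + cube_side Q))%R) H.
have /(_ (Ordinal n0)) : cube_set Q (\row_i (cube_center Q ord0 i + cube_side Q))%R.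
  by apply: H => i; rewrite mxE /= addrAC subrr add0r ger0_norm ?(ltW s0)//; lra.
by rewrite mxE addrAC subrr add0r ger0_norm ?(ltW s0)//; lra.
Qed.

(** With Q' = 5 Q_0, the larger cube 2 Q_0 is chosen so that its star 10 Q_0 is
    2 Q': the difference then lives on the single annulus R_1(Q'). The factor
    (2^n)^m compares |2 Q'|^m with |Q'|^m. *)
Lemma condition_T1_of_size (C : R) : (0 < n)%N -> (0 <= C)%R ->
  (forall Q x, dilate 2^-1 Q x -> size_term normB r KK Q x <= C%:E) ->
  condition_T1 normB r TT (2 * ((2 ^+ n) ^+ m * C)).
Proof.
move=> n0 C0 KKC Q0.
have s0 := cube_side_gt0 Q0.
pose Q := scale_cube (ltr0Sn R 1) Q0; pose Q' := scale_cube (ltr0Sn R 4) Q0.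
have starQ : star Q = dilate (2 ^+ 1) Q'.
  by rewrite /star !dilate_scale_cube; congr dilate; ring.
have starQ0 : star Q0 = dilate (2 ^+ 0) Q'.
  by rewrite /star !dilate_scale_cube; congr dilate; ring.
exists Q; first exact: proper_scale_cube2.
move=> f fL; apply: ge_ereal_sup => _ [x Q0x <-].
pose g := vrestrict f (star Q).
have gL : vLr r g by apply: vLr_vrestrict => //; exact: measurable_star.
have gE : vrestrict g (star Q0) = vrestrict f (star Q0).
  by apply: vrestrict_vrestrict; rewrite starQ starQ0; apply: subset_dilate; lra.
pose Phi y := (tensor g y - tensor (vrestrict g (star Q0)) y)%R.
have normPhi y : normc (Phi y) = (\1_(annulus 1 Q') y * normc (tensor f y))%R.
  rewrite /Phi tensor_sub_vrestrict normc_indicM tensor_vrestrict normc_indicM mulrA.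
  congr (_ * _)%R; rewrite starQ starQ0 /annulus !indicE in_setC in_setD.
  by rewrite mulrC; case: (_ \in _); case: (_ \in _); rewrite /= ?(mulr0,mul0r,mulr1).
have mPhi : measurable_fun setT (fun y => normc (Phi y)).
  under eq_fun do rewrite normPhi.
  apply: measurable_funM; last exact: (measurable_normc_tensor fL).
  by apply: measurable_indic; exact: measurable_annulus.
apply: (le_trans (weighted_norm_cintegral mD mw w0 (mu := mu) (measurable_normc_KK x) mPhi _)).
  apply: filterS (far gL Q0x) => o Ho Do; have [i1 e1] := Ho Do.
  by split => //; rewrite -[RHS]e1 gE.
rewrite EFinM -muleA; apply: lee_wpmul2l; first by rewrite lee_fin.
rewrite (_ : \int[_]_y _ = \int[mu]_(y in annulus 1 Q')
    (normB (KK x y) * (\prod_(i < m) normc (f i (tnth y i)))%:E)); last first.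
  rewrite [RHS]integral_mkcond; apply: eq_integral => y _; rewrite patchE normPhi indicE.
  by case: (_ \in _); rewrite ?mul1r -?normc_tensor// mul0r mule0.
apply: (le_trans (annulus_hoelder _ _ r1 _ _ fL)).
- exact: measurable_weighted_norm.
- by move=> y; exact: weighted_norm_ge0.
rewrite -starQ; apply: lee_wpmul2r; first by apply: prode_ge0 => i _; exact: average_ge0.
have volE : (vol (star Q) ^+ m)%R = ((2 ^+ n) ^+ m * vol (cube_set Q') ^+ m)%R.
  rewrite starQ /cube_set !vol_dilate//. by move: (cube_side Q') => s'; rewrite expr1 mul1r !exprMn.
rewrite volE !EFinM -muleA; apply: lee_wpmul2l.
  by rewrite lee_fin !exprn_ge0.
apply: KKC; rewrite dilate_scale_cube; apply: subset_dilate Q0x; lra.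
Qed.

(** The annuli R_j(Q') of Q' = 5Q exhaust the complement of (Q^* )^m, and each
    2^j Q' contains Q. *)
Lemma condition_T2_of_smoothness (C : R) : (0 < C)%R ->
  (forall Q x x', dilate 2^-1 Q x -> dilate 2^-1 Q x' ->
     smoothness_term normB r KK Q x x' <= C%:E) ->
  condition_T2 normB r TT (2 * C).
Proof.
move=> C0 KKC Q f fL; apply: ge_ereal_sup => _ [x [x' [Qx Qx' ->]]].
have s0 := cube_side_gt0 Q.
pose Q' := scale_cube (ltr0Sn R 4) Q.
have starQ : star Q = dilate (2 ^+ 0) Q'.
  by rewrite /star !dilate_scale_cube; congr dilate; ring.
pose Phi y := (tensor f y - tensor (vrestrict f (star Q)) y)%R.
have normPhi y : normc (Phi y) = (\1_(~` power_set (star Q)) y * normc (tensor f y))%R.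
  by rewrite /Phi tensor_sub_vrestrict normc_indicM.
have mPhi : measurable_fun setT (fun y => normc (Phi y)).
  under eq_fun do rewrite normPhi.
  apply: measurable_funM; last exact: (measurable_normc_tensor fL).
  apply: measurable_indic; apply: measurableC.
  by apply: measurable_power_set; exact: measurable_star.
pose dK y o := (KK x y o - KK x' y o)%R.
have mdK : measurable_fun ([set: Rnm] `*` D) (fun p => normc (dK p.1 p.2)).
  apply: measurable_normc; have [a b] := mKK x; have [a' b'] := mKK x'; split.
    apply: (eq_measurable_fun (fun p =>
      complex.Re (KK x p.1 p.2) - complex.Re (KK x' p.1 p.2))%R) => [p _|].
      by rewrite /dK; case: (KK x _ _) (KK x' _ _) => ? ? [].
    exact: measurable_funB.
  apply: (eq_measurable_fun (fun p =>
    complex.Im (KK x p.1 p.2) - complex.Im (KK x' p.1 p.2))%R) => [p _|].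
    by rewrite /dK; case: (KK x _ _) (KK x' _ _) => ? ? [].
  exact: measurable_funB.
pose N y := normB (dK y).
have mN : measurable_fun setT N by exact: measurable_weighted_norm.
have N0 y : 0 <= N y by exact: weighted_norm_ge0.
apply: (le_trans (weighted_norm_cintegral mD mw w0 (mu := mu) mdK mPhi _)).
  apply: filterS2 (far fL Qx) (far fL Qx') => o Ho Ho' Do.
  have [i1 e1] := Ho Do; have [i2 e2] := Ho' Do.
  have kE : (fun y => dK y o * Phi y)%R =
    (fun y => KK x y o * (tensor f y - tensor (vrestrict f (star Q)) y) -
              KK x' y o * (tensor f y - tensor (vrestrict f (star Q)) y))%R.
    by apply/funext => y; rewrite -mulrBl.
  rewrite kE; split; first exact: cintegrableB.
  by rewrite cintegralB// -e1 -e2.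
rewrite EFinM -muleA; apply: lee_wpmul2l; first by rewrite lee_fin.
set P := \prod_(i < m) _.
have P0 : 0 <= P.
  apply: prode_ge0 => i _; apply: (@le_trans _ _ (average r (f i) (cube_set Q))).
    exact: average_ge0.
  by apply: ereal_sup_ubound; exists Q.
(* the successive differences of F are F 0, where Phi vanishes, and the annuli *)
pose F j : set Rnm := power_set (dilate (2 ^+ j) Q').
have ndF : nondecreasing_seq F.
  move=> a b ab; apply/subsetPset => y Fy i.
  by apply: subset_dilate (Fy i); rewrite ler_eXn2l// ltr1n.
have mF j : measurable (F j) by apply: measurable_power_set; exact: measurable_dilate.
have mSF j : measurable (seqD F j).
  by case: j => [|j] //=; exact: measurableD.
have FT : \bigcup_j seqD F j = setT.
  rewrite eq_bigcup_seqD; apply/seteqP; split => // y _.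
  pose c := cube_center Q'; pose s := cube_side Q'.
  (* M bounds all coordinates of all the y_i relative to the center *)
  pose M := (\sum_(i < m) \sum_(l < n) `|tnth y i ord0 l - c ord0 l|)%R.
  have M0 : (0 <= M)%R by apply: sumr_ge0 => i _; exact: sumr_ge0.
  have sgt0 : (0 < s)%R by exact: cube_side_gt0.
  exists (Num.truncn (M * 2 / s)).+1 => //= i l.
  apply: (@le_trans _ _ M).
    rewrite /M (bigD1 i)//= (bigD1 l)//= -addrA lerDl addr_ge0 ?sumr_ge0// => j _.
    exact: sumr_ge0.
  rewrite -/s ler_pdivlMr// -ler_pdivrMr//.
  apply: (@le_trans _ _ (Num.truncn (M * 2 / s)).+1%:R).
    by rewrite ltW// truncnS_gt.
  by rewrite -natrX ler_nat ltnW// ltn_expl.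
pose I y := N y * (normc (Phi y))%:E.
have I0 y : 0 <= I y by rewrite mule_ge0// lee_fin normc_ge0.
have mI : measurable_fun setT I.
  by apply: emeasurable_funM => //; exact/measurable_EFinP.
rewrite -[X in \int[mu]_(y in X) _]FT (_ : \int[mu]_(y in _) _ =
    \sum_(j <oo) \int[mu]_(y in seqD F j) I y); last first.
  apply: ge0_integral_bigcup => //.
  - by rewrite FT.
  - by move=> y _; exact: I0.
  - exact: trivIset_seqD.
have coef0 j : 0 <= (vol (dilate (2 ^+ j) Q') ^+ m)%:E * annulus_mean r j Q' N.
  apply: mule_ge0; last exact: annulus_mean_ge0.
  by rewrite lee_fin; apply/exprn_ge0/ltW/vol_dilate_gt0; exact: exprn_gt0.
have I_annulus j : (0 < j)%N ->
  \int[mu]_(y in seqD F j) I y <=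
    (vol (dilate (2 ^+ j) Q') ^+ m)%:E * annulus_mean r j Q' N * P.
  move=> j0.
  rewrite (_ : \int[mu]_(y in _) _ = \int[mu]_(y in annulus j Q')
    (N y * (\prod_(i < m) normc (f i (tnth y i)))%:E)); last first.
    case: j j0 => // j _; apply: eq_integral => y; rewrite inE => -[_ nFy].
    rewrite /I normPhi -normc_tensor indicE mem_set ?mul1r//= => /= Sy.
    apply: nFy => i; have := Sy i; rewrite starQ; apply: subset_dilate.
    by rewrite expr0 exprn_ege1// ler1n.
  apply: (le_trans (annulus_hoelder _ _ r1 mN N0 fL)).
  apply: lee_wpmul2l; first exact: coef0.
  apply: lee_prod => i; first exact: average_ge0.
  apply: ereal_sup_ubound => /=.
  have c0 : (0 < (2 ^+ j * 5) :> R)%R by rewrite mulr_gt0// exprn_gt0.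
  exists (scale_cube c0 Q).
    rewrite /= /cube_set dilate_scale_cube; apply: subset_dilate.
    rewrite mul1r; have : (1 <= 2 ^+ j :> R)%R by rewrite exprn_ege1// ler1n.
    lra.
  by rewrite /cube_set !dilate_scale_cube mul1r.
rewrite (nneseries_split 0 1); last by move=> j _; exact: integral_ge0.
rewrite add0n big_nat1.
rewrite [X in X + _ <= _](_ : _ = 0) ?add0e; last first.
  apply: integral0_eq => y Fy; rewrite /I normPhi indicE memNset ?mul0r ?mule0//=.
  by move=> /(_ _); apply; rewrite starQ.
have smooth : \sum_(1 <= j <oo)
    (vol (dilate (2 ^+ j) Q') ^+ m)%:E * annulus_mean r j Q' N <= C%:E.
  by apply: (KKC Q' x x'); rewrite dilate_scale_cube;
    [apply: subset_dilate Qx|apply: subset_dilate Qx']; lra.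
(* an infinite product of maximal averages makes the bound trivial *)
have [Pfin|] := boolP (P \is a fin_num); last first.
  rewrite ge0_fin_numE// -leNgt leye_eq => /eqP ->.
  by rewrite gt0_muley ?lte_fin// leey.
apply: (@le_trans _ _ (\sum_(1 <= j <oo)
    (fine P)%:E * ((vol (dilate (2 ^+ j) Q') ^+ m)%:E * annulus_mean r j Q' N))).
  rewrite [leLHS]eseries_cond [leRHS]eseries_cond.
  apply: lee_nneseries => [j _ _|j]; first by apply: integral_ge0 => y _; exact: I0.
  by move=> /= j0; rewrite fineK// [leRHS]muleC; exact: I_annulus.
rewrite nneseriesZl// muleC fineK//.
exact: lee_wpmul2r.
Qed.

End bounded_oscillation_from_kernel.

(** * Kernel representation of T_t away from the supports *)

Section telescoping.
Import numFieldNormedType.Exports.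
Local Open Scope classical_set_scope.
Local Open Scope complex_scope.
Context (R : realType) (n m : nat) (r : R).
Local Notation Rn := 'rV[R]_n.
Local Notation Rnm := (m.-tuple 'rV[R]_n).
Local Notation mu := (leb_m R n m).
Variables (K : R -> Rn -> Rnm -> R[i]) (T : R -> ('I_m -> Rn -> R[i]) -> Rn -> R[i]).
Hypotheses (r0 : 0 < r) (Tlin : multilinear_operator_family T r) (TK : has_kernel K T r).
Implicit Types (f : 'I_m -> Rn -> R[i]).

(** The ball of radius twice the side of Q about a point of Q stays inside 5Q. *)
Lemma not_supp_restrict_star (Q : cube R n) x (g : Rn -> R[i]) : cube_set Q x ->
  ~ supp (fun y => (\1_(~` star Q) y)%:C * g y) x.
Proof.
move=> Qx; have s0 := cube_side_gt0 Q.
have far_dist (a b c s : R) : `|a - b| < 2 * s -> `|a - c| <= 1 * s / 2 ->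
    `|b - c| <= 5 * s / 2.
  move=> ab ac; rewrite distrC in ab.
  apply: le_trans (ler_distD a b c) _; lra.
move=> /(_ (ball x (2 * cube_side Q))) [].
  by apply: nbhsx_ballx; rewrite mulr_gt0.
move=> y [/=]; rewrite indicE; case: (boolP (y \in _)); last by rewrite mul0r eqxx.
rewrite inE => nSy _ xy; apply: nSy => i; have := Qx i; have [_ /(_ ord0 i)] := xy.
exact: far_dist.
Qed.

Lemma tensor_vupdateD f i (c : R[i]) g h y :
  tensor (vupdate f i (fun u => c * g u + h u)) y =
  c * tensor (vupdate f i g) y + tensor (vupdate f i h) y.
Proof.
rewrite /tensor (bigD1 i)//= [X in _ = c * X + _](bigD1 i)//= [X in _ = _ + X](bigD1 i)//=.
rewrite /vupdate eqxx mulrDl -mulrA; congr (_ * (_ * _) + _ * _);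
  by apply: eq_bigr => j /negbTE ->.
Qed.

Definition restrict_below (A : set Rn) f (j : nat) : 'I_m -> Rn -> R[i] :=
  fun i => if (i < j)%N then vrestrict f A i else f i.

(** The functions f_i are replaced by their restrictions to Q^* one at a time.
    By multilinearity each replacement changes T_t(f) by the value of T_t at a
    tuple one entry of which lives outside Q^*, and such a value is given by the
    kernel. *)
Lemma telescoping f (Q : cube R n) x t : 0 < t -> vLr r f -> cube_set Q x ->
  let k y := kernel_ext K t x y * (tensor f y - tensor (vrestrict f (star Q)) y) in
  cintegrable mu k /\ T t f x - T t (vrestrict f (star Q)) x = cintegral mu k.
Proof.
move=> t0 fL Qx; pose h := restrict_below (star Q) f.
have mS : measurable (star Q) by exact: measurable_star.
have hL j : vLr r (h j).
  by move=> i; rewrite /h /restrict_below; case: ifP => _; [exact: Lr_restrict|exact: fL].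
have -> : vrestrict f (star Q) = h m.
  by apply/funext => i; rewrite /h /restrict_below ltn_ord.
suff H j : (j <= m)%N ->
  let k y := kernel_ext K t x y * (tensor f y - tensor (h j) y) in
  cintegrable mu k /\ T t f x - T t (h j) x = cintegral mu k by exact: H.
elim: j => [_|j IH jm] k.
  have h0 : h 0%N = f by apply/funext.
  have -> : k = fun=> 0 by apply/funext => y; rewrite /k h0 subrr mulr0.
  by rewrite h0 subrr cintegral0; split => //; exact: cintegrable0.
have [iH eH] := IH (ltnW jm).
pose i := Ordinal jm.
pose fin u := (\1_(star Q) u)%:C * f i u.
pose fout u := (\1_(~` star Q) u)%:C * f i u.
have finL : Lr r fin by exact: (Lr_restrict r0 mS (fL i)).
have foutL : Lr r fout by exact: (Lr_restrict r0 (measurableC mS) (fL i)).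
have hj : h j = vupdate (h j) i (fun u => 1 * fin u + fout u).
  apply/funext => l; rewrite /vupdate; case: eqP => // ->.
  rewrite /h /restrict_below ltnn; apply/funext => u.
  rewrite mul1r /fin /fout !indicE in_setC -mulrDl.
  by case: (_ \in _); rewrite /= ?addr0 ?add0r mul1r.
have hj1 : h j.+1 = vupdate (h j) i fin.
  apply/funext => l; rewrite /vupdate /h /restrict_below ltnS leq_eqVlt.
  case: (eqVneq l i) => [->|li]/=; rewrite ?eqxx//.
  by case: eqP => // lj; case/eqP: li; exact/val_inj.
pose e := vupdate (h j) i fout.
have eL : vLr r e.
  by move=> l; rewrite /e /vupdate; case: (l == i); [exact: foutL|exact: hL].
have [ie Te] : represented K T t e x.
  apply: TK => // /(_ i); rewrite /e /vupdate eqxx; exact: not_supp_restrict_star.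
have TE : T t (h j) x = T t (h j.+1) x + T t e x.
  by rewrite {1}hj (Tlin i 1 x t0 (hL j) finL foutL) mul1r -hj1.
have kE : k = fun y => kernel_ext K t x y * (tensor f y - tensor (h j) y) +
    kernel_integrand (kernel_ext K t x) e y.
  apply/funext => y; rewrite /k /kernel_integrand -/(tensor e y) -mulrDr; congr (_ * _).
  rewrite {1}hj tensor_vupdateD mul1r -hj1 -/e; ring.
rewrite kE; split; first exact: cintegrableD.
by rewrite cintegralD// -eH -Te TE; ring.
Qed.

End telescoping.

(** * Measurability of the kernels *)

Section kernel_measurability.
Import numFieldNormedType.Exports.
Local Open Scope classical_set_scope.
Local Open Scope complex_scope.
Context (R : realType) (n m : nat).
Local Notation Rn := 'rV[R]_n.
Local Notation Rnm := (m.-tuple 'rV[R]_n).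
Variable K : R -> Rn -> Rnm -> R[i].
Hypothesis mK : measurable_kernel_family K.

Local Notation Q3 := (Rn * Rnm * measurableTypeR R)%type.

Lemma measurable_off_diagonal :
  measurable [set q : Rn * Rnm | off_diagonal q.1 q.2].
Proof.
rewrite (_ : [set _ | _] = ~` \bigcap_(i in [set: 'I_m]) \bigcap_(l in [set: 'I_n])
    ((fun q : Rn * Rnm => rV_coord l (tnth q.2 i) - rV_coord l q.1) @^-1` [set 0])).
  apply: measurableC; apply: fin_bigcap_measurable => // i _.
  apply: fin_bigcap_measurable => // l _.
  rewrite -[X in measurable X]setTI.
  apply: measurable_funB => //.
    apply: (measurableT_comp (@measurable_rV_coord R n l)).
    exact: (measurableT_comp (@measurable_tnth _ Rn m i)).
  exact: (measurableT_comp (@measurable_rV_coord R n l)).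
apply/seteqP; split => -[x y]; rewrite /= /off_diagonal.
  move=> /existsP[i /eqP yx] H; apply: yx; apply/rowP => l.
  by have /eqP := H i I l I; rewrite subr_eq0 => /eqP.
move=> H; apply/existsP; apply: contrapT => nH; apply: H => i _ l _ /=.
have -> : tnth y i = x by apply/eqP; apply: contrapT => yx; apply: nH; exists i; exact/negP.
by rewrite subrr.
Qed.

Lemma measurable_kernel_ext : cmeasurable_fun [set q : Q3 | 0 < q.2]
  (fun q => kernel_ext K q.2 q.1.1 q.1.2).
Proof.
pose P : set Q3 := [set q | 0 < q.2].
pose O : set Q3 := [set q | off_diagonal q.1.1 q.1.2].
have mP : measurable P by exact: measurable_snd_gt0.
have mO : measurable O.
  have := @measurable_fst _ _ (Rn * Rnm)%type (measurableTypeR R) measurableT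
     _ measurable_off_diagonal.
  by rewrite setTI.
have PO : [set q : Q3 | 0 < q.2 /\ off_diagonal q.1.1 q.1.2] = P `&` O by [].
have [mRe mIm] := mK; split.
  rewrite (_ : (fun _ => _) = (fun q : Q3 => complex.Re (K q.2 q.1.1 q.1.2)) \_ O).
    by apply/(measurable_restrict _ mO mP); rewrite -PO.
  apply/funext => q; rewrite patchE /kernel_ext; case: ifPn => qO.
    by rewrite mem_set.
  by rewrite memNset//; exact/negP.
rewrite (_ : (fun _ => _) = (fun q : Q3 => complex.Im (K q.2 q.1.1 q.1.2)) \_ O).
  by apply/(measurable_restrict _ mO mP); rewrite -PO.
apply/funext => q; rewrite patchE /kernel_ext; case: ifPn => qO.
  by rewrite mem_set.
by rewrite memNset//; exact/negP.
Qed.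

Lemma measurable_kernel_ext_comp d (X : measurableType d) (D : set X)
    (phi : X -> Q3) : measurable D -> measurable_fun setT phi ->
  (forall u, D u -> 0 < (phi u).2) ->
  cmeasurable_fun D (fun u => kernel_ext K (phi u).2 (phi u).1.1 (phi u).1.2).
Proof.
move=> mD mphi Dphi; have [mRe mIm] := measurable_kernel_ext.
have mP : measurable [set q : Q3 | 0 < q.2] by exact: measurable_snd_gt0.
split.
  apply: (measurable_comp mP _ mRe); last exact: measurable_funTS.
  by move=> _ [u Du <-]; exact: Dphi.
apply: (measurable_comp mP _ mIm); last exact: measurable_funTS.
by move=> _ [u Du <-]; exact: Dphi.
Qed.

End kernel_measurability.

(** * Bounded oscillation for weighted L^2 norms *)

Section bounded_oscillation_criterion.
Import numFieldNormedType.Exports.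
Local Open Scope classical_set_scope.
Local Open Scope complex_scope.
Context (R : realType) (n m : nat) dW (W : measurableType dW).
Variables (nu : {sigma_finite_measure set W -> \bar R}) (D : set W) (w : W -> R).
Hypotheses (mD : measurable D) (mw : measurable_fun D w) (w0 : forall o, D o -> 0 <= w o).
Variables (r : R) (KK : 'rV[R]_n -> m.-tuple 'rV[R]_n -> W -> R[i])
  (TT : ('I_m -> 'rV[R]_n -> R[i]) -> 'rV[R]_n -> W -> R[i])
  (S : ('I_m -> 'rV[R]_n -> R[i]) -> 'rV[R]_n -> \bar R).
Local Notation normB := (weighted_norm nu D w).

Lemma bounded_oscillation_of_hormander : (0 < n)%N -> 1 <= r ->
  (forall x, cmeasurable_fun (setT `*` D) (fun p => KK x p.1 p.2)) ->
  far_represented nu D r KK TT ->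
  (forall f x, vLr r f -> S f x = normB (TT f x)) ->
  (forall (f : 'I_m -> 'rV[R]_n -> R[i]) (i : 'I_m) (g h : 'rV[R]_n -> R[i]) (c : R[i]) x,
    vLr r f -> Lr r g -> Lr r h ->
    {ae nu, forall o, D o -> TT (vupdate f i (fun y => c * g y + h y)) x o =
      c * TT (vupdate f i g) x o + TT (vupdate f i h) x o}) ->
  hormander normB r KK -> bounded_oscillation normB r S TT.
Proof.
move=> n0 r1 mKK far SE TTlin [size smooth]; split => //.
  move=> f i g h c x fL gL hL.
  rewrite (eq_weighted_norm (G := fun=> 0) mD w0).
    rewrite /weighted_norm integral0_eq ?poweR0r ?invr_neq0// => o _.
    by rewrite ComplexField.Normc.normc0 expr0n mul0r.
  by apply: filterS (TTlin f i g h c x fL gL hL) => o H Do; rewrite H// subrr.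
(* a supremum below +oo may be -oo or 0, while the constants must be positive *)
have bound (A : set (\bar R)) : (ereal_sup A < +oo)%E ->
    exists2 C : R, 0 < C & forall v, A v -> (v <= C%:E)%E.
  move=> Aoo; exists (fine (maxe 0%E (ereal_sup A)) + 1).
    by rewrite ltr_pwDr// fine_ge0// le_max lexx.
  move=> v Av; apply: (@le_trans _ _ (maxe 0%E (ereal_sup A))).
    by rewrite le_max ereal_sup_ubound// orbT.
  rewrite EFinD fineK ?leeDl ?lee_fin// ge0_fin_numE ?le_max ?lexx//.
  by rewrite gt_max ltry.
have [C1 C10 HC1] := bound _ size; have [C2 C20 HC2] := bound _ smooth.
exists (2 * ((2 ^+ n) ^+ m * C1)), (2 * C2); split.
- by rewrite !mulr_gt0// !exprn_gt0.
- by rewrite mulr_gt0.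
- apply: (condition_T1_of_size mD mw w0 r1 mKK far n0 (ltW C10)) => Q x Qx.
  by apply: HC1; exists Q, x.
- apply: (condition_T2_of_smoothness mD mw w0 r1 mKK far C20) => Q x x' Qx Qx'.
  by apply: HC2; exists Q, x, x'.
Qed.

End bounded_oscillation_criterion.

(** * Operators on the half space *)

(** On [0, +oo[ inversion is the power function of exponent -1. *)
Lemma measurable_funV_ge0 d (X : measurableType d) (R : realType) (D : set X) (f : X -> R) :
  measurable_fun D f -> (forall u, D u -> 0 <= f u) ->
  measurable_fun D (fun u => (f u)^-1).
Proof.
move=> mf f0; apply: (eq_measurable_fun (fun u => f u `^ (-1))) => [u|].
  by rewrite inE => Du; rewrite powR_inv1// f0.
by apply: (@measurableT_comp _ _ _ _ _ _ (@powR R ^~ (-1))) => //; exact: measurable_powR.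
Qed.

Section half_space_operators.
Import numFieldNormedType.Exports.
Local Open Scope classical_set_scope.
Local Open Scope complex_scope.
Context (R : realType) (n m : nat) (r : R).
Local Notation Rn := 'rV[R]_n.
Local Notation Rnm := (m.-tuple 'rV[R]_n).
Local Notation W := (Rn * measurableTypeR R)%type.
Local Notation mu := (leb_half_space R n).
Local Notation half := (@upper_half_space R n : set W).
Local Notation density := (fun p : W => (p.2 ^+ n.+1)^-1).
Variables (K : R -> Rn -> Rnm -> R[i]) (T : R -> ('I_m -> Rn -> R[i]) -> Rn -> R[i]).
Variable a : W -> R.
Hypotheses (r0 : 0 < r) (mK : measurable_kernel_family K)
  (mT : measurable_operator_family T r) (TK : has_kernel_ae K T r)
  (ma : measurable_fun half a).
Implicit Types (f : 'I_m -> Rn -> R[i]) (x : Rn).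

(** Both kernels K^(2) and K^(3) are K_t(x - z, y) times a factor a(z, t): the
    indicator of the cone, or the power of t / (t + |z|). *)
Definition shifted_kernel x (y : Rnm) (p : W) : R[i] :=
  (a p)%:C * kernel_ext K p.2 (x - p.1) y.

Definition shifted_operator f x (p : W) : R[i] :=
  cintegral (leb_m R n m) (kernel_integrand (fun y => shifted_kernel x y p) f).

Lemma normc_of_real (u : R) : normc u%:C = `|u|.
Proof. by rewrite normc_sqrtE/= expr0n/= addr0 sqrtr_sqr. Qed.

Lemma measurable_density : measurable_fun half density.
Proof.
apply: measurable_funV_ge0 => [|p p0]; last by rewrite exprn_ge0// ltW.
by apply: measurable_funX; apply: measurable_funTS; exact: measurable_snd.
Qed.

Lemma density_ge0 p : half p -> 0 <= density p.
Proof. by move=> p0; rewrite invr_ge0 exprn_ge0// ltW. Qed.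

(** The representation of T_t holds at almost every point of the half space, and
    [reflected x] transports null sets to null sets. *)
Lemma shifted_operatorE f x : vLr r f ->
  {ae mu, forall p, half p ->
    cintegrable (leb_m R n m) (kernel_integrand (fun y => shifted_kernel x y p) f) /\
    shifted_operator f x p = (a p)%:C * T p.2 f (x - p.1)}.
Proof.
move=> fL; apply: filterS (ae_reflected x (TK fL)) => p /= H p0.
have [ci TE] := H p0.
have kE : kernel_integrand (fun y => shifted_kernel x y p) f =
    fun y => (a p)%:C * kernel_integrand (kernel_ext K p.2 (x - p.1)) f y.
  by apply/funext => y; rewrite /kernel_integrand /shifted_kernel -mulrA.
rewrite /shifted_operator kE TE cintegralZ//; split => //.
exact: cintegrableZ.
Qed.

Lemma shifted_far_represented :
  far_represented mu half r shifted_kernel shifted_operator.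
Proof.
move=> f fL Q x Qx.
have gL : vLr r (vrestrict f (star Q)).
  by apply: vLr_vrestrict => //; exact: measurable_star.
apply: filterS2 (shifted_operatorE x fL) (shifted_operatorE x gL) => p Hf Hg p0.
have [if_ _] := Hf p0; have [ig _] := Hg p0.
have kE : (fun y => shifted_kernel x y p * (tensor f y - tensor (vrestrict f (star Q)) y)) =
    fun y => kernel_integrand (fun y => shifted_kernel x y p) f y -
    kernel_integrand (fun y => shifted_kernel x y p) (vrestrict f (star Q)) y.
  by apply/funext => y; rewrite mulrBr.
by rewrite /= kE; split; [exact: cintegrableB|rewrite cintegralB].
Qed.

Lemma shifted_operator_linear f (i : 'I_m) (g h : Rn -> R[i]) (c : R[i]) x :
  vLr r f -> Lr r g -> Lr r h ->
  {ae mu, forall p, half p ->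
    shifted_operator (vupdate f i (fun y => c * g y + h y)) x p =
    c * shifted_operator (vupdate f i g) x p + shifted_operator (vupdate f i h) x p}.
Proof.
move=> fL gL hL.
have updL u : Lr r u -> vLr r (vupdate f i u).
  by move=> uL j; rewrite /vupdate; case: (j == i); [exact: uL|exact: fL].
apply: filterS2 (shifted_operatorE x (updL _ gL)) (shifted_operatorE x (updL _ hL)) => p Hg Hh p0.
have [ig _] := Hg p0; have [ih _] := Hh p0.
rewrite {1}/shifted_operator (_ : kernel_integrand _ _ = fun y =>
    c * kernel_integrand (fun y => shifted_kernel x y p) (vupdate f i g) y +
    kernel_integrand (fun y => shifted_kernel x y p) (vupdate f i h) y).
  by rewrite cintegralD ?cintegralZ//; exact: cintegrableZ.
apply/funext => y; rewrite /kernel_integrand mulrCA -mulrDr; congr (_ * _).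
exact: tensor_vupdateD.
Qed.

Lemma measurable_shifted_kernel x :
  cmeasurable_fun (setT `*` half) (fun p : Rnm * W => shifted_kernel x p.1 p.2).
Proof.
have mD : measurable (([set: Rnm] `*` half) : set (Rnm * W)).
  by apply: measurableX => //; exact: measurable_upper_half_space.
pose phi (p : Rnm * W) : Rn * Rnm * measurableTypeR R := ((x - p.2.1, p.1), p.2.2).
have mphi : measurable_fun setT phi.
  apply: measurable_fun_pair => /=; last exact: (measurableT_comp measurable_snd).
  apply: measurable_fun_pair => //=; apply: measurable_rVB => //.
  exact: (measurableT_comp measurable_fst).
have [mRe mIm] := measurable_kernel_ext_comp mK mD mphi (fun p Dp => Dp.2).
have ma2 : measurable_fun (([set: Rnm] `*` half) : set (Rnm * W)) (fun p => a p.2).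
  apply: (measurable_comp (@measurable_upper_half_space R n) _ ma); last exact: measurable_funTS.
  by move=> _ [p [_ Dp] <-].
split.
  under eq_fun do rewrite /shifted_kernel ReZ.
  exact: measurable_funM.
under eq_fun do rewrite /shifted_kernel ImZ.
exact: measurable_funM.
Qed.

(** Substituting x - z for z moves the factor to a(x - z, t), which is the form in
    which it appears in S^(2) and S^(3). *)
Lemma weighted_norm_shifted_operator f x : vLr r f ->
  weighted_norm mu half density (shifted_operator f x) =
  ((\int[mu]_(p in half) (a (x - p.1, p.2) ^+ 2 *
     (normc (T p.2 f p.1) ^+ 2 / p.2 ^+ n.+1))%:E) `^ 2^-1)%E.
Proof.
move=> fL.
rewrite (eq_weighted_norm (G := fun p => (a p)%:C * T p.2 f (x - p.1))
  (@measurable_upper_half_space R n) density_ge0); last first.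
  by apply: filterS (shifted_operatorE x fL) => p H /H[].
pose G (p : W) := (a (x - p.1, p.2) ^+ 2 * (normc (T p.2 f p.1) ^+ 2 / p.2 ^+ n.+1))%:E.
congr (_ `^ _)%E; rewrite -(integral_reflected x (g := G)).
- apply: eq_integral => p _; rewrite /G /reflected/=; congr EFin.
  rewrite subKr -surjective_pairing ComplexField.Normc.normcM.
  by rewrite normc_of_real exprMn real_normK ?num_real// -mulrA.
- apply/measurable_EFinP; apply: measurable_funM; last first.
    apply: measurable_funM; last exact: measurable_density.
    by apply: measurable_funX; apply: measurable_normc; exact: mT.
  apply: measurable_funX.
  apply: (measurable_comp (@measurable_upper_half_space R n) _ ma); last first.
    exact: measurable_funTS (measurable_reflected x).
  by move=> _ [p p0 <-].
- by move=> p p0; rewrite lee_fin mulr_ge0 ?sqr_ge0// mulr_ge0 ?sqr_ge0// density_ge0.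
Qed.

Lemma bounded_oscillation_shifted (S : ('I_m -> Rn -> R[i]) -> Rn -> \bar R) :
  (0 < n)%N -> 1 <= r ->
  (forall f x, vLr r f -> S f x =
    ((\int[mu]_(p in half) (a (x - p.1, p.2) ^+ 2 *
     (normc (T p.2 f p.1) ^+ 2 / p.2 ^+ n.+1))%:E) `^ 2^-1)%E) ->
  hormander (weighted_norm mu half density) r shifted_kernel ->
  bounded_oscillation (weighted_norm mu half density) r S shifted_operator.
Proof.
move=> n0 r1 SE; apply: bounded_oscillation_of_hormander => //.
- exact: measurable_upper_half_space.
- exact: measurable_density.
- exact: density_ge0.
- exact: measurable_shifted_kernel.
- exact: shifted_far_represented.
- by move=> f x fL; rewrite SE// weighted_norm_shifted_operator.
- exact: shifted_operator_linear.
Qed.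

End half_space_operators.

(** * The three square operators *)

Section square_operator_instances.
Import numFieldNormedType.Exports.
Local Open Scope classical_set_scope.
Local Open Scope complex_scope.
Context (R : realType) (n : nat) (eta : R).
Local Notation Rn := 'rV[R]_n.
Local Notation W := (Rn * measurableTypeR R)%type.
Local Notation half := (@upper_half_space R n : set W).

Lemma measurable_weight (e : R) : measurable_fun half (fun p => weight p.1 p.2 e).
Proof.
rewrite /weight.
have mN : measurable_fun half (fun p : W => p.2 + enorm p.1).
  apply: measurable_funTS; apply: measurable_funD; first exact: measurable_snd.
  exact: (measurableT_comp (@measurable_enorm R n)).
apply: (@measurableT_comp _ _ _ _ _ _ (@powR R ^~ e)); first exact: measurable_powR.
apply: measurable_funM; first by apply: measurable_funTS; exact: measurable_snd.
apply: measurable_funV_ge0 => // p p0.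
by rewrite addr_ge0 ?enorm_ge0// ltW.
Qed.

Lemma weight_sqr (z : Rn) (t e : R) : weight z t (e / 2) ^+ 2 = weight z t e.
Proof.
by rewrite /weight -powR_mulrn ?powR_ge0// -powRrM divfK.
Qed.

Lemma measurable_Gamma0 : measurable (Gamma eta (0 : Rn) : set W).
Proof.
rewrite (_ : Gamma eta 0 = half `&` ((fun p : W => eta * p.2 - enorm (p.1 - 0)) @^-1` `]0, +oo[)).
  have mf : measurable_fun setT (fun p : W => eta * p.2 - enorm (p.1 - 0)).
    apply: measurable_funB.
      by apply: measurable_funM => //; exact: measurable_snd.
    apply: (measurableT_comp (@measurable_enorm R n)); exact: measurable_rVB.
  apply: measurableI; first exact: measurable_upper_half_space.
  rewrite -[X in measurable X]setTI; apply: mf => //.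
by apply/seteqP; split => -[z t]; rewrite /Gamma/= in_itv/= andbT subr_gt0.
Qed.

Lemma indic_Gamma x (p : W) : (\1_(Gamma eta 0) (x - p.1, p.2) : R) = \1_(Gamma eta x) p.
Proof.
have E : Gamma eta 0 (x - p.1, p.2) = Gamma eta x p.
  by rewrite /Gamma/= subr0 -enormN opprB.
by rewrite !indicE; congr (_%:R); congr nat_of_bool; apply/idP/idP; rewrite !inE E.
Qed.

End square_operator_instances.

Theorem theorem2p13 (R : realType) (n m : nat) (r lambda eta : R)
    (K : R -> 'rV[R]_n -> m.-tuple 'rV[R]_n -> R[i])
    (T : R -> ('I_m -> 'rV[R]_n -> R[i]) -> 'rV[R]_n -> R[i])
    (k : square_index) :
  (0 < n)%N -> (0 < m)%N -> 1 <= r -> m.*2%:R < lambda -> 0 < eta ->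
  measurable_kernel_family K ->
  multilinear_operator_family T r ->
  measurable_operator_family T r ->
  has_kernel K T r ->
  (k <> Square1 -> has_kernel_ae K T r) ->
  hormander (norm_B (k := k)) r (vkernel lambda eta K (k := k)) ->
  bounded_oscillation (norm_B (k := k)) r (square_op lambda eta T k)
    (voperator lambda eta K T (k := k)).
Proof.
move=> n0 _ r1 _ _ mK Tlin mT TK TKae.
have r0 : 0 < r := lt_le_trans ltr01 r1.
case: k TKae => TKae.
- have mP : measurable ([set t | 0 < t]%classic : set (measurableTypeR R)).
    rewrite (_ : [set t | 0 < t]%classic = `]0, +oo[%classic).
      exact: measurable_itv.
    by apply/seteqP; split => p; rewrite /= in_itv/= andbT.
  apply: (@bounded_oscillation_of_hormander R n m _ (measurableTypeR R)
    (@lebesgue_measure R) [set t | 0 < t]%classic (fun t => t^-1)) => //.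
  + by apply: (measurable_funV_ge0 (f := id)) => // t t0; exact: ltW.
  + by move=> t t0; rewrite invr_ge0 ltW.
  + move=> x; apply: (measurable_kernel_ext_comp mK (phi := fun p => ((x, p.1), p.2))).
    * by apply: measurableX.
    * apply: measurable_fun_pair => //=; apply: measurable_fun_pair => //=.
    * by move=> p [].
  + move=> f fL Q x Qx; apply: aeW => t t0.
    exact: (telescoping r0 Tlin TK).
  + move=> f i g h c x fL gL hL; apply: aeW => t t0; exact: Tlin.
- have mG : measurable_fun (@upper_half_space R n)
      (\1_(Gamma eta (0 : 'rV[R]_n)) : _ * measurableTypeR R -> R).
    by apply: measurable_indic; exact: measurable_Gamma0.
  have TK2 : has_kernel_ae K T r by exact: TKae.
  apply: (bounded_oscillation_shifted r0 mK mT TK2 mG n0 r1) => f x fL.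
  congr (_ `^ _)%E.
  rewrite integral_mkcond [RHS]integral_mkcond; apply: eq_integral => p _.
  rewrite !patchE indic_Gamma indicE; case: ifPn => [|pG].
    by rewrite inE => -[p0 _]; rewrite mem_set// expr1n mul1r.
  by rewrite expr0n mul0r; case: ifP.
- have TK3 : has_kernel_ae K T r by exact: TKae.
  apply: (bounded_oscillation_shifted r0 mK mT TK3
    (measurable_weight (n%:R * lambda / 2)) n0 r1) => f x fL.
  congr (_ `^ _)%E; apply: eq_integral => p _.
  by rewrite weight_sqr.
Qed.
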